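(* Let $X,Y$ be Hilbert spaces with $\dim X=\infty$, let $T\in\mathcal{B}(X,Y)$ with $\dim\mathcal{N}(T)<\infty$, and let $\{(X_n,T_n)\}_{n\in\mathbb{N}}$ be a least-squares projection approximation (LPA) for $T$. Set $$\theta_n:=\arcsin\,\mathrm{gap}\big(T^{\dagger}T(X_n),\,T^{*}T(X_n)\big)\qquad\forall n\in\mathbb{N}$$ (the offset angle of $X_n$ with respect to $T$). Let (KA) denote the condition $$\mathcal{N}(T)=\Big\{x\in X:\lim_{n\to\infty}\mathrm{dist}(x,\mathcal{N}(T)\cap X_n)=0\Big\}.$$ Then the following hold: (a) $\{\theta_n\}$ is a sequence in the interval $[0,\frac{\pi}{2})$, and $$\sup_n\|T_n^{\dagger}T\|<+\infty\iff\Big(\text{(KA) holds and }\sup_n\theta_n<\frac{\pi}{2}\Big).$$ (b) If (KA) holds, then there is an $n_*\in\mathbb{N}$ such that, for all $n\ge n_*$, $$\|T_n^{\dagger}y-T^{\dagger}y\|\le\sqrt{1+\tan^2\theta_n}\;\mathrm{dist}(T^{\dagger}y,X_n)\qquad\forall y\in\mathcal{D}(T^{\dagger}),$$ and $$\theta_n=0\iff T_n^{\dagger}=P_{X_n}T^{\dagger}\text{ on }\mathcal{D}(T^{\dagger})\iff\mathcal{N}(T)+T^{*}T(X_n)\subseteq X_n.$$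
   Context: $\mathcal{B}(X,Y)$ is the space of bounded linear operators from $X$ to $Y$; $T^*$ is the adjoint; $\mathcal{D},\mathcal{N},\mathcal{R}$ denote domain, kernel and range. $T^{\dagger}$ is the Moore-Penrose inverse of $T$: its domain is $\mathcal{D}(T^{\dagger})=\mathcal{R}(T)+\mathcal{R}(T)^{\perp}\subseteq Y$ and $T^{\dagger}y$ is the unique $x\in\mathcal{N}(T)^{\perp}$ with $Tx=P_{\overline{\mathcal{R}(T)}}\,y$. $P_M$ is the orthogonal projection onto a closed subspace $M$. LPA: $\{X_n\}$ is a sequence of finite-dimensional subspaces of $X$ such that $P_{X_n}x\to x$ for every $x\in X$, and $T_n:=TP_{X_n}$ for all $n\in\mathbb{N}$. Each $T_n$ has finite rank, so $T_n^{\dagger}$ is bounded and defined on all of $Y$. Gap: for closed subspaces $M,N$ of a Hilbert space, $\mathrm{gap}(M,N):=\max\{\delta(M,N),\delta(N,M)\}$, where $\delta(M,N):=\sup\{\mathrm{dist}(x,N):x\in M,\|x\|=1\}$ if $M\ne\{0\}$, and $\delta(M,N):=0$ if $M=\{0\}$. *)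

(* Defs.v *)
From HB Require Import structures.
From mathcomp Require Import all_boot all_order all_algebra.
From mathcomp Require Import complex.
From mathcomp Require Import all_classical all_reals all_analysis.

Set Implicit Arguments.
Unset Strict Implicit.
Unset Printing Implicit Defensive.

Import Order.TTheory GRing.Theory Num.Theory.
Import numFieldNormedType.Exports.

Local Open Scope classical_set_scope.
Local Open Scope ring_scope.

(* The ground field is R or R[i]; quantifying over [scalar_kind] treats real and
   complex Hilbert spaces at once. *)
Variant scalar_kind := real_scalars | complex_scalars.

Definition scalar_field (R : realType) (s : scalar_kind) : numFieldType :=
  match s with
  | real_scalars => R : numFieldType
  | complex_scalars => R[i] : numFieldType
  end.

Definition sconj (R : realType) (s : scalar_kind) : scalar_field R s -> scalar_field R s :=
  match s with
  | real_scalars => @idfun R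
  | complex_scalars => @conjc R
  end.

Definition sre (R : realType) (s : scalar_kind) : scalar_field R s -> R :=
  match s with
  | real_scalars => @idfun R
  | complex_scalars => @complex.Re R
  end.

HB.mixin Record CompleteNormedModule_isHilbert (R : realType) (s : scalar_kind)
    X & CompleteNormedModule (scalar_field R s) X := {
  inner : {dot X for @sconj R s};
  sqr_norm_inner : forall x : X, `|x| ^+ 2 = inner x x
}.

(* The inner product is linear in its first argument and conjugate-linear in
   its second one. *)
#[short(type="hilbertType")]
HB.structure Definition Hilbert (R : realType) (s : scalar_kind) :=
  {X of CompleteNormedModule (scalar_field R s) X
      & CompleteNormedModule_isHilbert R s X}.

Section Hilbert_space.
Context {R : realType} {s : scalar_kind}.

(* The norm `|x| takes its values in [scalar_field R s], where it is a nonnegative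
   real; [rnorm x] is the same number as an element of R. *)
Definition rnorm (X : hilbertType R s) (x : X) : R := sre `|x|.

Definition dist_set (X : hilbertType R s) (x : X) (A : set X) : R :=
  inf [set rnorm (x - a) | a in A].

Definition orthocomp (X : hilbertType R s) (A : set X) : set X :=
  [set x | forall a, A a -> inner x a = 0].

Definition fin_dim_subspace (X : hilbertType R s) (V : set X) : Prop :=
  exists (n : nat) (e : 'I_n -> X),
    V = [set \sum_(i < n) c i *: e i | c in [set: 'I_n -> scalar_field R s]].

Definition orthoproj (X : hilbertType R s) (M : set X) (x : X) : X :=
  xget 0 [set p | M p /\ orthocomp M (x - p)].

Definition sumset (X : hilbertType R s) (A B : set X) : set X :=
  [set a + b | a in A & b in B].

Definition gap_delta (X : hilbertType R s) (M N : set X) : R :=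
  if `[< M = [set 0] >] then 0
  else sup [set dist_set x N | x in M `&` [set x | rnorm x = 1]].

Definition gap (X : hilbertType R s) (M N : set X) : R :=
  Num.max (gap_delta M N) (gap_delta N M).

Section Operators.
Context {X Y : hilbertType R s}.

Definition bounded_operator (T : {linear X -> Y}) : Prop :=
  exists C : R, forall x, rnorm (T x) <= C * rnorm x.

Definition opnorm (T : X -> Y) : \bar R :=
  ereal_sup [set (rnorm (T x))%:E | x in [set x | rnorm x <= 1]].

Definition ker (T : X -> Y) : set X := [set x | T x = 0].

Definition adjoint (T : X -> Y) (y : Y) : X :=
  xget 0 [set z | forall x, inner (T x) y = inner x z].

Definition mp_dom (T : X -> Y) : set Y :=
  sumset (range T) (orthocomp (range T)).

(* The partial operator of domain [mp_dom T], extended by 0. *)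
Definition mp_inv (T : X -> Y) (y : Y) : X :=
  xget 0 [set x | orthocomp (ker T) x /\ T x = orthoproj (closure (range T)) y].

Definition LPA (T : X -> Y) (Xn : nat -> set X) (Tn : nat -> X -> Y) : Prop :=
  [/\ forall n, fin_dim_subspace (Xn n),
      forall x : X, (fun n => orthoproj (Xn n) x) @ \oo --> x &
      forall n, Tn n = T \o orthoproj (Xn n)].

Definition offset_angle (T : X -> Y) (V : set X) : R :=
  asin (gap ((mp_inv T \o T) @` V) ((adjoint T \o T) @` V)).

Definition kernel_approximability (T : X -> Y) (Xn : nat -> set X) : Prop :=
  ker T = [set x | (fun n => dist_set x (ker T `&` Xn n)) @ \oo --> (0 : R)].

End Operators.
End Hilbert_space.

(* Main.v *)
Require Import Defs.
From mathcomp Require Import all_boot all_order all_algebra.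
From mathcomp Require Import complex ring lra.
From mathcomp Require Import all_classical all_reals all_analysis.

(* Write N = ker T, V = X_n, A = T^dagger T(V) (the projection of V on the orthogonal
   complement of N) and B = T^* T(V). The operator E_n = T_n^dagger T sends x to the
   only x' in V, orthogonal to N /\ V, such that x - x' is orthogonal to B; when N is
   contained in V, it is on the complement of N the oblique projection onto A along the
   complement of B.
   A bound |E_n x| <= C |x| gives |a| <= C |P_B a| for a in A and |b| <= C |P_A b| for
   b in B, hence gap(A, B) <= sqrt(1 - C^-2); as each E_n is bounded, every gap is < 1.
   A uniform bound also gives (KA), since P_V u - E_n (P_V u) lies in N /\ V when T u = 0.
   Conversely (KA) forces N to be contained in X_n for n large because N is
   finite-dimensional; then e = E_n x - P_V x lies in A, x - E_n x is orthogonal to B and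
   x - P_V x to e, so that |e| <= gap(A, B) |x - E_n x| and Pythagoras' theorem gives the
   error estimate. *)

Set Implicit Arguments.
Unset Strict Implicit.
Unset Printing Implicit Defensive.

Import Order.TTheory GRing.Theory Num.Theory.
Import numFieldNormedType.Exports.

Local Open Scope classical_set_scope.
Local Open Scope ring_scope.

(** * Scalars: passing between [scalar_field R s] and [R] *)

Definition of_real (R : realType) (s : scalar_kind) : R -> scalar_field R s :=
  match s with
  | real_scalars => @idfun R
  | complex_scalars => real_complex R
  end.

Section scalars.
Context {R : realType} {s : scalar_kind}.
Implicit Types (k l : scalar_field R s) (r : R).

Definition modulus k : R := sre `|k|.

Lemma sreD k l : sre (k + l) = sre k + sre l.
Proof. by case: s k l => //= -[? ?] [? ?]. Qed.

Lemma sreN k : sre (- k) = - sre k.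
Proof. by case: s k => //= -[? ?]. Qed.

Lemma sreB k l : sre (k - l) = sre k - sre l.
Proof. by rewrite sreD sreN. Qed.

Lemma sre_conj k : sre (sconj k) = sre k.
Proof. by case: s k => //= -[? ?]. Qed.

Lemma sre_of_realM r k : sre (of_real s r * k) = r * sre k.
Proof. by case: s k => //= -[a b] /=; rewrite mul0r subr0. Qed.

Lemma of_realK r : sre (of_real s r) = r.
Proof. by case: s. Qed.

Lemma sreK k : 0 <= k -> of_real s (sre k) = k.
Proof.
case: s k => //= -[a b]; rewrite lecE /= => /andP[/eqP -> _].
by [].
Qed.

Lemma le_sre k l : k <= l -> sre k <= sre l.
Proof. by case: s k l => //= k l; rewrite lecE => /andP[]. Qed.

Lemma of_real_le r q : (of_real s r <= of_real s q) = (r <= q).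
Proof. by case: s => //=; rewrite lecR. Qed.

Lemma of_real_lt r q : (of_real s r < of_real s q) = (r < q).
Proof. by case: s => //=; rewrite ltcR. Qed.

Lemma modulusK k : of_real s (modulus k) = `|k|.
Proof. by rewrite sreK. Qed.

Lemma modulus_ge0 k : 0 <= modulus k.
Proof. by rewrite -(of_real_le _ _) modulusK; case: s k => //= k; rewrite normr_ge0. Qed.

Lemma modulus_real r : modulus (of_real s r) = `|r|.
Proof.
rewrite /modulus; case: s => //=.
by rewrite expr0n addr0 sqrtr_sqr.
Qed.

Lemma sre_mulJ k : sre (sconj k * k) = modulus k ^+ 2.
Proof.
rewrite /modulus; case: s k => /= [k|k]; first by rewrite real_normK ?num_real// expr2.
case: k => a b /=; rewrite sqr_sqrtr ?addr_ge0 ?sqr_ge0//.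
by ring.
Qed.

Lemma sre0 : sre (0 : scalar_field R s) = 0.
Proof. by case: s. Qed.

Lemma of_real0 : of_real s (0 : R) = 0.
Proof. by case: s. Qed.

Lemma sconj0 : sconj (0 : scalar_field R s) = 0.
Proof. by case: s => //=; rewrite oppr0. Qed.

Lemma modulus_conj k : modulus (sconj k) = modulus k.
Proof. by rewrite /modulus; case: s k => [//|k]; rewrite [LHS](congr1 _ (normcJ k)). Qed.

Lemma modulus_eq0 k : modulus k = 0 -> k = 0.
Proof. by move=> h; apply/eqP; rewrite -normr_eq0 -modulusK h of_real0. Qed.

End scalars.

(** * Inner product and norm, Cauchy-Schwarz, linear subspaces *)

Section inner_product.
Context {R : realType} {s : scalar_kind} {X : hilbertType R s}.
Implicit Types (x y z : X) (k : scalar_field R s) (r : R) (A B V W : set X).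

Definition rinner x y : R := sre (inner x y).

Lemma rnormK x : of_real s (rnorm x) = `|x|.
Proof. by rewrite sreK. Qed.

Lemma rinnerDl x y z : rinner (x + y) z = rinner x z + rinner y z.
Proof. by rewrite /rinner linearDl sreD. Qed.

Lemma rinnerNl x y : rinner (- x) y = - rinner x y.
Proof. by rewrite /rinner linearNl sreN. Qed.

Lemma rinnerBl x y z : rinner (x - y) z = rinner x z - rinner y z.
Proof. by rewrite rinnerDl rinnerNl. Qed.

Lemma innerC x y : inner x y = sconj (inner y x).
Proof. by rewrite [LHS]hermitian_subproof expr0 mul1r. Qed.

Lemma rinnerC x y : rinner x y = rinner y x.
Proof. by rewrite /rinner innerC sre_conj. Qed.

Lemma rinnerDr x y z : rinner z (x + y) = rinner z x + rinner z y.
Proof. by rewrite rinnerC rinnerDl !(rinnerC z). Qed.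

Lemma rinnerNr x y : rinner y (- x) = - rinner y x.
Proof. by rewrite rinnerC rinnerNl (rinnerC y). Qed.

Lemma rinnerBr x y z : rinner z (x - y) = rinner z x - rinner z y.
Proof. by rewrite rinnerDr rinnerNr. Qed.

Lemma innerZl k x y : inner (k *: x) y = k * inner x y.
Proof. exact: linearZl_LR. Qed.

Lemma rinnerZl r x y : rinner (of_real s r *: x) y = r * rinner x y.
Proof. by rewrite /rinner innerZl sre_of_realM. Qed.

Lemma rinnerZr r x y : rinner x (of_real s r *: y) = r * rinner x y.
Proof. by rewrite rinnerC rinnerZl rinnerC. Qed.

Lemma innerDl x y z : inner (x + y) z = inner x z + inner y z.
Proof. exact: linearDl. Qed.

Lemma innerNl x y : inner (- x) y = - inner x y.
Proof. exact: linearNl. Qed.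

Lemma inner0l x : inner 0 x = 0. Proof. exact: linear0l. Qed.

Lemma rinner0l x : rinner 0 x = 0.
Proof. by rewrite /rinner inner0l sre0. Qed.

Lemma rinner0r x : rinner x 0 = 0.
Proof. by rewrite rinnerC rinner0l. Qed.

Lemma rinnerxx x : rinner x x = rnorm x ^+ 2.
Proof.
rewrite /rinner -sqr_norm_inner /rnorm.
by rewrite -[in LHS](rnormK x) expr2 sre_of_realM of_realK -expr2.
Qed.

Lemma rnorm_ge0 x : 0 <= rnorm x.
Proof.
have := normr_ge0 x; rewrite -rnormK => h; have := le_sre h.
by rewrite of_realK sre0.
Qed.

Lemma rnorm_eq0 x : rnorm x = 0 -> x = 0.
Proof.
by move=> h; apply/eqP; rewrite -normr_eq0 -rnormK h of_real0.
Qed.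

Lemma rnorm0 : rnorm (0 : X) = 0.
Proof. by rewrite /rnorm normr0 sre0. Qed.

Lemma rnormZ k x : rnorm (k *: x) = modulus k * rnorm x.
Proof. by rewrite /rnorm normrZ -modulusK sre_of_realM. Qed.

Lemma rnormN x : rnorm (- x) = rnorm x.
Proof. by rewrite /rnorm normrN. Qed.

Lemma rnormB x y : rnorm (x - y) = rnorm (y - x).
Proof. by rewrite -rnormN opprB. Qed.

Lemma rnormD x y : rnorm (x + y) <= rnorm x + rnorm y.
Proof. by rewrite -sreD; apply/le_sre/ler_normD. Qed.

Lemma rnormD_sqr x y : rnorm (x + y) ^+ 2 = rnorm x ^+ 2 + 2 * rinner x y + rnorm y ^+ 2.
Proof. by rewrite -!rinnerxx rinnerDl !rinnerDr (rinnerC y x); ring. Qed.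

Lemma rnormB_sqr x y : rnorm (x - y) ^+ 2 = rnorm x ^+ 2 - 2 * rinner x y + rnorm y ^+ 2.
Proof. by rewrite rnormD_sqr rinnerNr rnormN; ring. Qed.

(** The squared norm of |y| x - |x| y is nonnegative; expand it and divide by 2 |x| |y|. *)
Lemma cauchy_schwarz x y : rinner x y <= rnorm x * rnorm y.
Proof.
have [y0|y0] := eqVneq (rnorm y) 0.
  by rewrite (rnorm_eq0 y0) rnorm0 mulr0 rinner0r.
have yp : 0 < rnorm y by rewrite lt_def y0 rnorm_ge0.
have [x0|x0] := eqVneq (rnorm x) 0.
  by rewrite (rnorm_eq0 x0) rnorm0 mul0r rinner0l.
have xp : 0 < rnorm x by rewrite lt_def x0 rnorm_ge0.
have := sqr_ge0 (rnorm (of_real s (rnorm y) *: x - of_real s (rnorm x) *: y)).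
rewrite rnormB_sqr !rnormZ !modulus_real rinnerZl rinnerZr !(ger0_norm (rnorm_ge0 _)).
move=> h; rewrite -subr_ge0 -(pmulr_rge0 _ (mulr_gt0 xp yp)).
nra.
Qed.

Lemma cauchy_schwarz_abs x y : `|rinner x y| <= rnorm x * rnorm y.
Proof.
by rewrite ler_norml cauchy_schwarz andbT lerNl -rinnerNl -(rnormN x) cauchy_schwarz.
Qed.

(** Scaling [x] by the conjugate of [inner x y] makes the inner product real, so that the inequality
    for real parts applies. *)
Lemma modulus_inner x y : modulus (inner x y) <= rnorm x * rnorm y.
Proof.
have [->|h0] := eqVneq (modulus (inner x y)) 0; first by rewrite mulr_ge0 ?rnorm_ge0.
have h : 0 < modulus (inner x y) by rewrite lt_def h0 modulus_ge0.
rewrite -(ler_pM2l h) -expr2 -sre_mulJ -innerZl -/(rinner _ _).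
apply: le_trans (cauchy_schwarz _ _) _; by rewrite rnormZ mulrA modulus_conj.
Qed.

Lemma inner_eq0C x y : inner x y = 0 -> inner y x = 0.
Proof. by move=> h; rewrite innerC h sconj0. Qed.

Lemma inner_rinner x y : inner x y = 0 -> rinner x y = 0.
Proof. by rewrite /rinner => ->; rewrite sre0. Qed.

Lemma inner0_rnorm x : inner x x = 0 -> x = 0.
Proof.
move=> /inner_rinner; rewrite rinnerxx => /eqP; rewrite sqrf_eq0 => /eqP.
exact: rnorm_eq0.
Qed.

Definition linear_subspace V := V 0 /\ forall k x y, V x -> V y -> V (k *: x + y).

Lemma subspace0 V : linear_subspace V -> V 0. Proof. by case. Qed.

Lemma subspaceD V x y : linear_subspace V -> V x -> V y -> V (x + y).
Proof. by move=> [_ h] Vx Vy; rewrite -[x]scale1r; apply: h. Qed.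

Lemma subspaceZ V k x : linear_subspace V -> V x -> V (k *: x).
Proof. by move=> [h0 h] Vx; rewrite -[_ *: _]addr0; apply: h. Qed.

Lemma subspaceN V x : linear_subspace V -> V x -> V (- x).
Proof. by rewrite -scaleN1r; apply: subspaceZ. Qed.

Lemma subspaceB V x y : linear_subspace V -> V x -> V y -> V (x - y).
Proof. by move=> sV Vx Vy; apply: subspaceD => //; apply: subspaceN. Qed.

Lemma subspaceI V W : linear_subspace V -> linear_subspace W -> linear_subspace (V `&` W).
Proof.
by move=> [a b] [c d]; split=> // k x y [? ?] [? ?]; split; [apply: b|apply: d].
Qed.

Lemma orthocomp_subspace A : linear_subspace (orthocomp A).
Proof.
split=> [a _|k x y ox oy a Aa]; first exact: linear0l.
by rewrite innerDl innerZl ox// oy// mulr0 addr0.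
Qed.

End inner_product.

(** * Finite-dimensional subspaces and their orthogonal projections *)

Section finite_dimension.
Context {R : realType} {s : scalar_kind} {X : hilbertType R s}.
Implicit Types (x y z u : X) (k : scalar_field R s) (A B V W : set X).

(** The sum of [W] and the span of [u]; the coefficient is the only witness. *)
Definition add_line W u : set X := [set x | exists k, W (x - k *: u)].

Lemma fin_dim_subspaceP V : fin_dim_subspace V -> linear_subspace V.
Proof.
move=> [n [e ->]]; split.
  by exists (fun=> 0) => //; rewrite big1// => i _; rewrite scale0r.
move=> k _ _ [c _ <-] [d _ <-]; exists (fun i => k * c i + d i) => //.
rewrite scaler_sumr -big_split /=; apply: eq_bigr => i _.
by rewrite scalerDl scalerA.
Qed.

Lemma fin_dim0 : fin_dim_subspace [set (0 : X)].
Proof.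
exists 0%N, (fun=> 0); apply/seteqP; split=> [x ->|x [c _ <-]] /=; last by rewrite big_ord0.
by exists (fun=> 0) => //; rewrite big_ord0.
Qed.

Lemma fin_dim_add_line W u : fin_dim_subspace W -> fin_dim_subspace (add_line W u).
Proof.
move=> [n [e ->]]; exists n.+1, (fun i => oapp e u (unlift ord0 i)).
have E c : \sum_(i < n.+1) c i *: oapp e u (unlift ord0 i) =
    c ord0 *: u + \sum_(i < n) c (lift ord0 i) *: e i.
  rewrite big_ord_recl unlift_none /=; congr +%R.
  by apply: eq_bigr => i _; rewrite liftK.
apply/seteqP; split=> x /=.
  move=> [k [c _ cE]]; exists (fun i => oapp c k (unlift ord0 i)) => //.
  rewrite E unlift_none /=; under eq_bigr do rewrite liftK /=.
  by rewrite cE addrC subrK.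
move=> [c _ <-]; exists (c ord0), (fun i => c (lift ord0 i)) => //.
by rewrite E addrAC subrr add0r.
Qed.

(** Induction on the length of a spanning family. The family may be dependent, so [u] may already
    lie in [W], a case that several uses treat apart. *)
Lemma fin_dim_ind (P : set X -> Prop) : P [set 0] ->
  (forall W u, fin_dim_subspace W -> P W -> P (add_line W u)) ->
  forall V, fin_dim_subspace V -> P V.
Proof.
move=> P0 Pl V [n [e ->]]; elim: n e => [|n IH] e.
  suff -> : [set \sum_(i < 0) c i *: e i | c in [set: 'I_0 -> scalar_field R s]] = [set 0] by [].
  apply/seteqP; split=> [x [c _ <-]|x ->] /=; first by rewrite big_ord0.
  by exists (fun=> 0) => //; rewrite big_ord0.
have := Pl _ (e ord0) (ex_intro _ n (ex_intro _ _ erefl)) (IH (fun i => e (lift ord0 i))).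
congr P; apply/seteqP; split=> x /=.
  move=> [k [c _ cE]]; exists (fun i => oapp c k (unlift ord0 i)) => //.
  rewrite big_ord_recl unlift_none /=; under eq_bigr do rewrite liftK /=.
  by rewrite cE addrC subrK.
move=> [c _ <-]; exists (c ord0), (fun i => c (lift ord0 i)) => //.
by rewrite big_ord_recl addrAC subrr add0r.
Qed.

Lemma add_line_sub W u : W `<=` add_line W u.
Proof. by move=> x Wx; exists 0; rewrite scale0r subr0. Qed.

Lemma add_line_gen W u : linear_subspace W -> add_line W u u.
Proof. by move=> sW; exists 1; rewrite scale1r subrr; apply: subspace0. Qed.

Lemma add_line_id W u : linear_subspace W -> W u -> add_line W u = W.
Proof.
move=> sW Wu; apply/seteqP; split; last exact: add_line_sub.
by move=> x [k]; rewrite -{2}(subrK (k *: u) x) => h; apply: subspaceD => //; apply: subspaceZ.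
Qed.

(** If [W] is not inside the smaller space, it has a vector [w0] with nonzero coefficient along [u];
    subtracting a multiple of [w0] brings any vector of [W] into the smaller space. *)
Lemma fin_dim_sub W V : linear_subspace W -> fin_dim_subspace V -> W `<=` V -> fin_dim_subspace W.
Proof.
move=> + fV; move: V fV W; apply: fin_dim_ind => [|V u fV IH] W sW WV.
  suff -> : W = [set 0] by exact: fin_dim0.
  by apply/seteqP; split=> // _ ->; apply: subspace0.
have sV := fin_dim_subspaceP fV.
have fW' : fin_dim_subspace (W `&` V).
  by apply: IH => [|x []//]; exact: subspaceI.
have [WsV|/existsNP[w0 /not_implyP[Ww0 Vw0]]] := pselect (W `<=` V).
  by suff -> : W = W `&` V by []; rewrite setIidl.
have [k Vk] := WV _ Ww0.
have k0 : k != 0 by apply/eqP => k0; apply: Vw0; move: Vk; rewrite k0 scale0r subr0.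
suff -> : W = add_line (W `&` V) w0 by exact: fin_dim_add_line.
apply/seteqP; split=> x.
  move=> Wx; have [l Vl] := WV _ Wx; exists (l / k); split.
    by apply: subspaceB => //; apply: subspaceZ.
  have -> : x - (l / k) *: w0 = (x - l *: u) - (l / k) *: (w0 - k *: u).
    by rewrite scalerBr scalerA divfK// opprB addrA subrK.
  by apply: subspaceB => //; apply: subspaceZ.
move=> [l [h _]]; rewrite -(subrK (l *: w0) x).
by apply: subspaceD => //; apply: subspaceZ.
Qed.

Lemma orthocomp_add_line W u x :
  orthocomp W x -> inner x u = 0 -> orthocomp (add_line W u) x.
Proof.
move=> oW ou v [k Wk]; apply: inner_eq0C.
rewrite -(subrK (k *: u) v) innerDl innerZl (inner_eq0C ou) mulr0 addr0.
exact/inner_eq0C/oW.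
Qed.

(** Gram-Schmidt: [v] is the part of [u] orthogonal to [W], and the projection gains the component
    of [x] along [v]. *)
Lemma orthoproj_exists V : fin_dim_subspace V ->
  forall x, exists p, V p /\ orthocomp V (x - p).
Proof.
move: V; apply: fin_dim_ind => [|W u fW IH] x.
  by exists 0; split=> // a ->; apply: inner_eq0C; rewrite inner0l.
have sW := fin_dim_subspaceP fW.
have [Wu|Wu] := pselect (W u); first by rewrite add_line_id.
have [p [Wp op]] := IH x; have [q [Wq oq]] := IH u.
set v := u - q in oq.
have v0 : inner v v != 0.
  by apply/eqP => /inner0_rnorm /eqP; rewrite subr_eq0 => /eqP uq; apply: Wu; rewrite uq.
set c := inner x v / inner v v.
exists (p + c *: v); split.
  exists c; rewrite /v scalerBr addrA addrAC addrK.
  by apply: subspaceB => //; apply: subspaceZ.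
have sO := orthocomp_subspace W.
have oW : orthocomp W (x - (p + c *: v)).
  by rewrite opprD addrA; exact: subspaceB sO op (subspaceZ c sO oq).
apply: orthocomp_add_line => //.
apply: inner_eq0C; rewrite -(subrK q u) innerDl -/v.
rewrite [inner q _]inner_eq0C ?oW// addr0; apply: inner_eq0C.
rewrite opprD addrA innerDl -scaleNr innerZl mulNr divfK//.
have -> : inner (x - p) v = inner x v.
  rewrite innerDl innerNl (_ : inner p v = 0) ?subr0//.
  exact/inner_eq0C/oq.
by rewrite subrr.
Qed.

Lemma orthoprojP V x : fin_dim_subspace V ->
  V (orthoproj V x) /\ orthocomp V (x - orthoproj V x).
Proof.
move=> fV; have [p hp] := orthoproj_exists fV x.
exact: (@xgetPex _ 0 [set p | V p /\ orthocomp V (x - p)] (ex_intro _ p hp)).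
Qed.

Lemma orthoproj_mem V x : fin_dim_subspace V -> V (orthoproj V x).
Proof. by move=> /(orthoprojP x)[]. Qed.

Lemma orthoproj_res V x : fin_dim_subspace V -> orthocomp V (x - orthoproj V x).
Proof. by move=> /(orthoprojP x)[]. Qed.

Lemma orthocomp_mem0 V x : V x -> orthocomp V x -> x = 0.
Proof. by move=> Vx /(_ _ Vx)/inner0_rnorm. Qed.

Lemma orthoproj_eq V x p : linear_subspace V -> V p -> orthocomp V (x - p) -> orthoproj V x = p.
Proof.
move=> sV Vp op; apply: xget_unique; first by split.
move=> q [Vq oq]; apply/eqP; rewrite eq_sym -subr_eq0; apply/eqP.
apply: (@orthocomp_mem0 V); first exact: subspaceB.
have -> : p - q = (x - q) - (x - p) by rewrite opprB [RHS]addrC addrA subrK.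
exact: subspaceB (orthocomp_subspace _) oq op.
Qed.

Lemma orthoproj_id V x : linear_subspace V -> V x -> orthoproj V x = x.
Proof.
move=> sV Vx; apply: orthoproj_eq => //; rewrite subrr.
exact: subspace0 (orthocomp_subspace _).
Qed.

Lemma orthoproj_linear V k x y : fin_dim_subspace V ->
  orthoproj V (k *: x + y) = k *: orthoproj V x + orthoproj V y.
Proof.
move=> fV; have sV := fin_dim_subspaceP fV.
apply: orthoproj_eq => //; first by apply: sV.2; apply: orthoproj_mem.
rewrite opprD addrACA -scalerBr.
by apply: (orthocomp_subspace V).2; apply: orthoproj_res.
Qed.

Lemma orthoproj_pythagoras V x a : fin_dim_subspace V -> V a ->
  rnorm (x - a) ^+ 2 = rnorm (x - orthoproj V x) ^+ 2 + rnorm (orthoproj V x - a) ^+ 2.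
Proof.
move=> fV Va; have sV := fin_dim_subspaceP fV.
have -> : x - a = (x - orthoproj V x) + (orthoproj V x - a) by rewrite addrA subrK.
rewrite rnormD_sqr inner_rinner ?mulr0 ?addr0//.
by apply: orthoproj_res => //; apply: subspaceB => //; apply: orthoproj_mem.
Qed.

Lemma orthoproj_res_le V x a : fin_dim_subspace V -> V a ->
  rnorm (x - orthoproj V x) <= rnorm (x - a).
Proof.
move=> fV Va; rewrite -ler_sqr ?nnegrE ?rnorm_ge0//.
by rewrite (@orthoproj_pythagoras _ x a fV Va) lerDl sqr_ge0.
Qed.

Lemma rnorm_orthoproj V x : fin_dim_subspace V ->
  rnorm x ^+ 2 = rnorm (x - orthoproj V x) ^+ 2 + rnorm (orthoproj V x) ^+ 2.
Proof.
move=> fV; have := @orthoproj_pythagoras V x 0 fV (subspace0 (fin_dim_subspaceP fV)).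
by rewrite !subr0.
Qed.

Lemma orthoproj_res_norm V x : fin_dim_subspace V -> rnorm (x - orthoproj V x) <= rnorm x.
Proof.
move=> fV; rewrite -[X in _ <= rnorm X]subr0; apply: orthoproj_res_le => //.
exact: subspace0 (fin_dim_subspaceP fV).
Qed.

Lemma dist_set_orthoproj V x : fin_dim_subspace V ->
  dist_set x V = rnorm (x - orthoproj V x).
Proof.
move=> fV; apply/eqP; rewrite eq_le; apply/andP; split.
  apply: ge_inf; last by exists (orthoproj V x) => //; apply: orthoproj_mem.
  by exists 0 => _ [a _ <-]; apply: rnorm_ge0.
apply: lb_le_inf; first by exists (rnorm (x - orthoproj V x)), (orthoproj V x) => //;
    exact: orthoproj_mem.
by move=> _ [a Va <-]; apply: orthoproj_res_le.
Qed.

Lemma add_line_res W u v k : fin_dim_subspace W -> W (v - k *: u) ->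
  v - orthoproj W v = k *: (u - orthoproj W u).
Proof.
move=> fW Wk; have sW := fin_dim_subspaceP fW.
have {1 2}-> : v = k *: u + (v - k *: u) by rewrite addrC subrK.
by rewrite orthoproj_linear// (orthoproj_id sW Wk) scalerBr opprD addrACA subrr addr0.
Qed.

(** The constant is the inverse of the distance from [u] to [W]: modulo [W], [v] is [k *: u], so its
    residual off [W] has norm [modulus k] times that distance. *)
Lemma add_line_coef W u : fin_dim_subspace W -> ~ W u ->
  exists2 c : R, 0 <= c & forall v k, W (v - k *: u) ->
    modulus k <= c * rnorm v /\ rnorm (v - k *: u) <= (1 + c * rnorm u) * rnorm v.
Proof.
move=> fW Wu; set d := rnorm (u - orthoproj W u).
have d0 : 0 < d.
  rewrite lt_def rnorm_ge0 andbT; apply/eqP => /rnorm_eq0/eqP; rewrite subr_eq0 => /eqP e.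
  by apply: Wu; rewrite e; apply: orthoproj_mem.
exists d^-1 => [|v k Wk]; first by rewrite invr_ge0 ltW.
have hk : modulus k <= d^-1 * rnorm v.
  rewrite mulrC ler_pdivlMr// -rnormZ -(add_line_res fW Wk); exact: orthoproj_res_norm.
split=> //; apply: le_trans (rnormD _ _) _; rewrite rnormN rnormZ mulrDl mul1r lerD2l.
by rewrite mulrAC ler_wpM2r// rnorm_ge0.
Qed.

(** Pointwise convergence on a finite-dimensional space is uniform on its unit ball. By induction,
    [x] splits into [k *: u] and a vector of [W], both controlled by [rnorm x] through
    [add_line_coef]. *)
Lemma orthoproj_res_uniform V (K : nat -> set X) : fin_dim_subspace V ->
  (forall n, fin_dim_subspace (K n)) ->
  (forall x, V x -> dist_set x (K n) @[n --> \oo] --> (0 : R)) ->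
  forall e : R, 0 < e -> exists n0 : nat, forall n, (n0 <= n)%N -> forall x, V x ->
    rnorm (x - orthoproj (K n) x) <= e * rnorm x.
Proof.
move=> + fK; move: V; apply: fin_dim_ind => [_ e e0|W u fW IH cvgK e e0].
  exists 0%N => n _ x ->; apply: le_trans (orthoproj_res_norm _ (fK n)) _.
  by rewrite rnorm0 mulr0.
have sW := fin_dim_subspaceP fW.
have cvgW x : W x -> dist_set x (K n) @[n --> \oo] --> (0 : R).
  by move=> Wx; apply: cvgK; apply: add_line_sub.
have [Wu|Wu] := pselect (W u); first by rewrite add_line_id//; apply: IH.
have [c c0 hc] := add_line_coef fW Wu.
set C := 1 + c * rnorm u.
have C0 : 0 < C by rewrite ltr_pwDl// mulr_ge0// rnorm_ge0.
have [n1 h1] := IH cvgW (e / 2 / C) (divr_gt0 (divr_gt0 e0 (ltr0Sn _ _)) C0).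
(* Each component may use [e / 2]; the divisor is [c + 1] because only [0 <= c] is known. *)
have c1 : 0 < c + 1 by rewrite ltr_wpDl.
have /cvgrPdist_lt/(_ (e / 2 / (c + 1)) (divr_gt0 (divr_gt0 e0 (ltr0Sn _ _)) c1)) :=
  cvgK _ (add_line_gen u sW).
move=> [n2 _ h2]; exists (maxn n1 n2) => n; rewrite geq_max => /andP[n1n n2n] x [k Wk].
have [hk hw] := hc _ _ Wk.
have := h2 n n2n; rewrite /= sub0r normrN dist_set_orthoproj// => /ltW /(le_trans (ler_norm _)) ku.
have kw := h1 n n1n _ Wk.
have -> : x - orthoproj (K n) x = k *: (u - orthoproj (K n) u) +
    ((x - k *: u) - orthoproj (K n) (x - k *: u)).
  have {1 2}-> : x = k *: u + (x - k *: u) by rewrite addrC subrK.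
  by rewrite orthoproj_linear// scalerBr opprD addrACA.
apply: le_trans (rnormD _ _) _; rewrite rnormZ.
have a1 : modulus k * rnorm (u - orthoproj (K n) u) <= e / 2 * rnorm x.
  apply: le_trans (ler_pM (modulus_ge0 _) (rnorm_ge0 _) hk ku) _.
  rewrite mulrAC ler_wpM2r ?rnorm_ge0//.
  rewrite mulrA ler_pdivrMr// mulrC ler_wpM2l ?divr_ge0 ?(ltW e0)//.
  by rewrite lerDl.
have a2 : e / 2 / C * rnorm (x - k *: u) <= e / 2 * rnorm x.
  by rewrite -mulrA ler_pM2l ?divr_gt0// mulrC ler_pdivrMr// mulrC.
apply: le_trans (lerD a1 (le_trans kw a2)) _.
by rewrite -mulrDl -splitr.
Qed.

End finite_dimension.

(** * Linear maps on finite-dimensional subspaces *)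

Section finite_dimensional_maps.
Context {R : realType} {s : scalar_kind} {X Y : hilbertType R s}.
Variable f : X -> Y.
Hypothesis f_linear : linear f.

Let f0 : f 0 = 0.
Proof. by have := f_linear (-1) 0 0; rewrite scaleN1r oppr0 addr0 scaleN1r addNr. Qed.

Lemma image_add_line (W : set X) (u : X) :
  f @` add_line W u = add_line (f @` W) (f u).
Proof.
apply/seteqP; split=> y.
  move=> [x [k Wk] <-]; exists k, (x - k *: u) => //.
  by rewrite addrC -scaleNr f_linear scaleNr addrC.
move=> [k [w Ww e]]; exists (k *: u + w).
  by exists k; rewrite addrAC subrr add0r.
by rewrite f_linear e addrC subrK.
Qed.

Lemma image_set0 : f @` [set 0] = [set 0].
Proof. by rewrite image_set1 f0. Qed.

Lemma fin_dim_image V : fin_dim_subspace V -> fin_dim_subspace (f @` V).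
Proof.
move: V; apply: fin_dim_ind => [|W u fW IH].
  by rewrite image_set0; apply: fin_dim0.
by rewrite image_add_line; apply: fin_dim_add_line.
Qed.

(** Induction replaces compactness: injectivity keeps [f u] outside the image of [W], so
    [add_line_coef] in [Y] bounds both the coefficient of [u] and the image of the rest. *)
Lemma fin_dim_bounded_below V : fin_dim_subspace V ->
  (forall x, V x -> f x = 0 -> x = 0) ->
  exists2 c : R, 0 <= c & forall x, V x -> rnorm x <= c * rnorm (f x).
Proof.
move: V; apply: fin_dim_ind => [_|W u fW IH injf].
  by exists 0 => // x ->; rewrite rnorm0 mul0r.
have sW := fin_dim_subspaceP fW.
have [c c0 hc] := IH (fun x Wx => injf x (@add_line_sub _ _ _ _ _ _ Wx)).
have [Wu|Wu] := pselect (W u).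
  by exists c => //; rewrite add_line_id.
have Wfu : ~ (f @` W) (f u).
  move=> [w Ww e]; apply: Wu.
  have /injf h : add_line W u ((-1) *: w + u).
    by exists 1; rewrite scale1r addrK; apply: subspaceZ.
  have := h; rewrite f_linear e scaleN1r addNr => /(_ erefl) /eqP.
  by rewrite scaleN1r addrC subr_eq0 => /eqP ->.
have [d d0 hd] := add_line_coef (fin_dim_image fW) Wfu.
exists (c * (1 + d * rnorm (f u)) + d * rnorm u).
  by rewrite addr_ge0 ?mulr_ge0 ?rnorm_ge0 ?addr_ge0 ?mulr_ge0 ?rnorm_ge0.
move=> x [k Wk].
have e : f (x - k *: u) = f x - k *: f u by rewrite addrC -scaleNr f_linear scaleNr addrC.
have fWk : (f @` W) (f x - k *: f u) by rewrite -e; exists (x - k *: u).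
have [h1 h2] := hd _ _ fWk; have := hc _ Wk; rewrite e => h3.
rewrite -{1}(subrK (k *: u) x) mulrDl; apply: le_trans (rnormD _ _) _; apply: lerD.
  by apply: le_trans h3 _; rewrite -mulrA ler_wpM2l.
by rewrite rnormZ mulrAC ler_wpM2r ?rnorm_ge0.
Qed.

End finite_dimensional_maps.

(** * Completeness: Riesz representation, projection onto closures *)

Section completeness.
Context {R : realType} {s : scalar_kind} {X : hilbertType R s}.

(** The radii of convergence in a normed module live in [scalar_field R s]; being positive, they
    come from real numbers. *)
Lemma cvg_rnormP (u : nat -> X) (l : X) : u @ \oo --> l <->
  forall e : R, 0 < e -> exists n0 : nat, forall n, (n0 <= n)%N -> rnorm (l - u n) < e.
Proof.
split=> [/cvgrPdist_lt h e e0|h].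
  have /h[n0 _ hn] : 0 < of_real s e by rewrite -(of_real0 (R := R)) of_real_lt.
  by exists n0 => n /hn /=; rewrite -rnormK of_real_lt.
apply/cvgrPdist_lt => e e0.
have eE : of_real s (sre e) = e by rewrite sreK// ltW.
have [|n0 hn] := h (sre e); first by rewrite -(of_real_lt (s := s)) of_real0 eE.
by exists n0 => // n /= /hn; rewrite -(of_real_lt (s := s)) rnormK eE.
Qed.

Lemma cauchy_rnorm (u : nat -> X) :
  (forall e : R, 0 < e -> exists n0 : nat, forall n m, (n0 <= n)%N -> (n0 <= m)%N ->
    rnorm (u n - u m) < e) -> exists l : X, u @ \oo --> l.
Proof.
move=> h; exists (limn u); apply: cauchy_cvg.
apply/cauchy_ballP => e e0.
have eE : of_real s (sre e) = e by rewrite sreK// ltW.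
have [|n0 hn] := h (sre e); first by rewrite -(of_real_lt (s := s)) of_real0 eE.
exists (u @` [set n | (n0 <= n)%N], u @` [set n | (n0 <= n)%N]).
  by split; exists n0 => // n /= nn; exists n.
move=> [_ _] /= [[n nn <-] [m mm <-]]; rewrite -ball_normE /=.
by rewrite -rnormK -eE of_real_lt; apply: hn.
Qed.

Lemma natSinv_lt (e : R) : 0 < e ->
  exists n0 : nat, forall n, (n0 <= n)%N -> n.+1%:R^-1 < e.
Proof.
by move=> e0; have [n0 _ h] := near_infty_natSinv_lt (PosNum e0); exists n0 => n /h.
Qed.

Section riesz.
Variables (g : X -> R) (C : R).
Hypothesis gD : forall x y, g (x + y) = g x + g y.
Hypothesis gZ : forall r x, g (of_real s r *: x) = r * g x.
Hypothesis g_bounded : forall x, `|g x| <= C * rnorm x.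

(* Near-minimizers of [|x|^2 - 2 g x] represent [g] up to a small error. *)
Let riesz_approx (d : R) : 0 < d ->
  exists y, forall x, `|rinner x y - g x| <= d * rnorm x.
Proof.
move=> d0; pose F x := rnorm x ^+ 2 - 2 * g x.
have F_inf : has_inf (range F).
  split; first by exists (F 0), 0.
  (* Complete the square in |x|^2 - 2 C |x|. *)
  exists (- C ^+ 2) => _ [x _ <-]; rewrite /F.
  have := le_trans (ler_norm _) (g_bounded x); have := sqr_ge0 (rnorm x - C).
  by rewrite sqrrB; lra.
have [_ [y _ <-] Fy] := inf_adherent (exprn_gt0 2 d0) F_inf.
exists y => x.
have [x0|x0] := eqVneq (rnorm x) 0.
  have : `|g x| == 0.
    by rewrite eq_le normr_ge0 andbT; have := g_bounded x; rewrite x0 mulr0.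
  rewrite normr_eq0 => /eqP ->.
  by rewrite (rnorm_eq0 x0) rinner0l subrr normr0 rnorm0 mulr0.
have xp : 0 < rnorm x ^+ 2 by rewrite exprn_gt0// lt_def x0 rnorm_ge0.
set a := rinner x y - g x.
have hr r : - d ^+ 2 <= r ^+ 2 * rnorm x ^+ 2 + 2 * r * a.
  have : F y - d ^+ 2 <= F (y + of_real s r *: x).
    rewrite lerBlDr; apply: le_trans (ltW Fy) _; rewrite lerD2r.
    by apply: ge_inf; [exact: F_inf.2|exists (y + of_real s r *: x)].
  rewrite /F rnormD_sqr gD gZ rnormZ modulus_real exprMn real_normK ?num_real//.
  rewrite rinnerZr (rinnerC y x) /a; lra.
rewrite -ler_sqr ?nnegrE ?mulr_ge0 ?rnorm_ge0 ?(ltW d0)//.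
rewrite real_normK ?num_real// exprMn.
(* The minimizer of the quadratic in [hr], whose value there is - a^2 / |x|^2. *)
pose r := - a / rnorm x ^+ 2.
have e : (r ^+ 2 * rnorm x ^+ 2 + 2 * r * a) * rnorm x ^+ 2 = - a ^+ 2.
  by rewrite /r; field.
by have := ler_wpM2r (ltW xp) (hr r); rewrite e mulNr lerN2.
Qed.

(** Approximate representatives with errors 1 / (n + 1) form a Cauchy sequence, and its limit
    represents [g] exactly. *)
Lemma riesz_real : exists z, forall x, g x = rinner x z.
Proof.
have d0 n : 0 < n.+1%:R^-1 :> R by rewrite invr_gt0.
have [u hu] := choice (fun n => riesz_approx (d0 n)).
have [|z /cvg_rnormP uz] := @cauchy_rnorm u.
  move=> e e0; have e20 : 0 < e / 2 by rewrite divr_gt0.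
  have [n0 h0] := natSinv_lt e20; exists n0 => n m nn nm.
  (* The two representatives are compared on their own difference, which yields |x|^2 <= (1 / (n +
     1) + 1 / (m + 1)) |x|. *)
  set x := u n - u m.
  have [-> //|x0] := eqVneq (rnorm x) 0.
  have xp : 0 < rnorm x by rewrite lt_def x0 rnorm_ge0.
  rewrite -(ltr_pM2r xp) -expr2 -rinnerxx {2}/x rinnerBr.
  have := hu n x; have := hu m x; rewrite !ler_norml => /andP[hm _] /andP[_ hn].
  have am : m.+1%:R^-1 * rnorm x < e / 2 * rnorm x by rewrite ltr_pM2r// h0.
  have an : n.+1%:R^-1 * rnorm x < e / 2 * rnorm x by rewrite ltr_pM2r// h0.
  move: hm hn am an.
  move: (rnorm x) (m.+1%:R^-1 * _) (n.+1%:R^-1 * _) (rinner x _) (rinner x _) (g x) => *.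
  lra.
exists z => x; apply/eqP; rewrite eq_sym -subr_eq0 -normr_eq0.
rewrite eq_le normr_ge0 andbT; apply/ler_addgt0Pr => e e0; rewrite add0r.
have e1 : 0 < e / 2 / (rnorm x + 1).
  by rewrite !divr_gt0// ltr_wpDl// rnorm_ge0.
have [n0 h0] := natSinv_lt e1; have [n1 h1] := uz _ e1.
have {}h0 := ltW (h0 _ (leq_maxl n0 n1)); have {}h1 := ltW (h1 _ (leq_maxr n0 n1)).
set n := maxn n0 n1 in h0 h1.
have -> : rinner x z - g x = rinner x (z - u n) + (rinner x (u n) - g x).
  by rewrite rinnerBr; ring.
have xe : e / 2 / (rnorm x + 1) * rnorm x <= e / 2.
  rewrite mulrAC ler_pdivrMr; last by rewrite ltr_wpDl// rnorm_ge0.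
  by rewrite ler_wpM2l ?divr_ge0 ?(ltW e0)// lerDl.
apply: le_trans (ler_normD _ _) _; rewrite (splitr e); apply: lerD.
  apply: le_trans (cauchy_schwarz_abs _ _) _.
  by rewrite mulrC; apply: le_trans xe; rewrite ler_wpM2r ?rnorm_ge0.
by apply: le_trans (hu n x) _; apply: le_trans xe; rewrite ler_wpM2r ?rnorm_ge0.
Qed.

End riesz.

(** Continuity of the inner product: a point of the closure is replaced by a point of [M] at
    distance less than e / (|w| + 1). *)
Lemma orthocomp_closure (M : set X) : orthocomp M `<=` orthocomp (closure M).
Proof.
move=> w ow q cq; apply/modulus_eq0/eqP.
rewrite eq_le modulus_ge0 andbT; apply/ler_addgt0Pr => e e0; rewrite add0r.
set d := e / (rnorm w + 1).
have d0 : 0 < d by rewrite divr_gt0// ltr_wpDl// rnorm_ge0.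
have [|a [Ma]] := cq (ball q (of_real s d)).
  by apply: nbhsx_ballx; rewrite -(of_real0 (R := R)) of_real_lt.
rewrite -ball_normE /= -rnormK of_real_lt => /ltW aq.
have -> : modulus (inner w q) = modulus (inner (q - a) w).
  rewrite innerC modulus_conj innerDl innerNl [inner a w]inner_eq0C ?subr0//.
  exact: ow.
apply: le_trans (modulus_inner _ _) _.
apply: le_trans (ler_wpM2r (rnorm_ge0 _) aq) _.
rewrite /d mulrAC ler_pdivrMr; last by rewrite ltr_wpDl// rnorm_ge0.
by rewrite ler_wpM2l ?(ltW e0)// lerDl.
Qed.

(** When [M] is the range of an operator, the sums [m + w] are the points of [mp_dom]. Uniqueness
    holds because a second candidate [q] makes [m - q] orthogonal to both [m] and [q]. *)
Lemma orthoproj_closure (M : set X) (m w : X) : M m -> orthocomp M w ->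
  orthoproj (closure M) (m + w) = m.
Proof.
move=> Mm ow; have cm := subset_closure Mm.
apply: xget_unique => [|q [cq oq]].
  by split=> //; rewrite addrAC subrr add0r; apply: orthocomp_closure.
apply/eqP; rewrite eq_sym -subr_eq0; apply/eqP/inner0_rnorm.
have o : orthocomp (closure M) (m - q).
  have -> : m - q = (m + w - q) - w by rewrite addrAC addrK.
  exact: subspaceB (orthocomp_subspace _) oq (orthocomp_closure ow).
by rewrite innerDl innerNl (inner_eq0C (o _ cm)) (inner_eq0C (o _ cq)) subr0.
Qed.

End completeness.

(** * Moore-Penrose inverse and adjoint *)

Section operators.
Context {R : realType} {s : scalar_kind} {X Y : hilbertType R s}.

(** The working criterion for values of [mp_inv]: [f x] is the projection of [f x + w], and two
    solutions orthogonal to the kernel differ by a kernel vector, hence coincide. *)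
Lemma mp_inv_eq (f : X -> Y) (x : X) (w : Y) : linear f ->
  orthocomp (ker f) x -> orthocomp (range f) w -> mp_inv f (f x + w) = x.
Proof.
move=> lf ox ow; rewrite /mp_inv orthoproj_closure//.
apply: xget_unique => // q [oq fq]; apply/eqP; rewrite -subr_eq0; apply/eqP.
apply: (@orthocomp_mem0 _ _ _ (ker f)).
  by rewrite /ker /= addrC -scaleN1r lf fq scaleN1r addNr.
exact: subspaceB (orthocomp_subspace _) oq ox.
Qed.

Variable T : {linear X -> Y}.

Lemma ker_subspace : linear_subspace (ker T).
Proof.
by split=> [|k x y]; rewrite /ker /= ?linear0// => Tx Ty; rewrite linearP Tx Ty scaler0 addr0.
Qed.

Lemma adjointP : bounded_operator T -> forall x y, inner (T x) y = inner x (adjoint T y).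
Proof.
move=> [C hC] x y.
have [|||z hz] := @riesz_real _ _ _ (fun x => rinner (T x) y) (C * rnorm y).
- by move=> a b; rewrite linearD rinnerDl.
- by move=> r a; rewrite linearZ rinnerZl.
- move=> a; apply: le_trans (cauchy_schwarz_abs _ _) _.
  by rewrite mulrAC ler_wpM2r ?rnorm_ge0.
have h : exists z, [set z | forall x, inner (T x) y = inner x z] z.
  (* The Riesz vector matches real parts only. Testing it on [a] times the conjugate of the
     discrepancy turns that real part into a squared modulus. *)
  exists z => a; apply/eqP; rewrite -subr_eq0; apply/eqP/modulus_eq0/eqP.
  rewrite -sqrf_eq0 -sre_mulJ mulrBr -!innerZl -linearZ sreB -!/(rinner _ _) hz.
  by rewrite subrr.
exact: (@xgetPex _ 0 _ h).
Qed.

End operators.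

(** * Gap between subspaces *)

Section gap_theory.
Context {R : realType} {s : scalar_kind} {X : hilbertType R s}.
Implicit Types (M N : set X).

Lemma gap_delta_le M N (c : R) : fin_dim_subspace N -> 0 <= c ->
  (forall a, M a -> rnorm (a - orthoproj N a) <= c * rnorm a) -> gap_delta M N <= c.
Proof.
move=> fN c0 h; rewrite /gap_delta; case: ifP => // _.
set S := [set _ | _ in _]; have [->|/set0P S0] := eqVneq S set0; first by rewrite sup0.
apply: ge_sup => // _ [a [Ma /= a1] <-].
by rewrite dist_set_orthoproj//; have := h _ Ma; rewrite a1 mulr1.
Qed.

Lemma gap_delta_ge0 M N : 0 <= gap_delta M N.
Proof.
rewrite /gap_delta; case: ifP => // _; set S := [set _ | _ in _].
have S0 d : S d -> 0 <= d.
  move=> [a _ <-]; rewrite /dist_set; set D := [set _ | _ in _].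
  have [->|/set0P D0] := eqVneq D set0; first by rewrite inf0.
  by apply: lb_le_inf => // _ [b _ <-]; apply: rnorm_ge0.
have [[[d Sd] uS]|/sup_out -> //] := pselect (has_sup S).
by apply: le_trans (S0 _ Sd) _; apply: ub_le_sup.
Qed.

Lemma gap_ge0 M N : 0 <= gap M N.
Proof. by rewrite le_max gap_delta_ge0. Qed.

(** The supremum runs over unit vectors, so [a] is rescaled; the distances are bounded by 1, which
    makes [sup] an upper bound. *)
Lemma gap_delta_orthoproj M N a : linear_subspace M -> fin_dim_subspace N -> M a ->
  rnorm (a - orthoproj N a) <= gap_delta M N * rnorm a.
Proof.
move=> sM fN Ma.
have [a0|a0] := eqVneq (rnorm a) 0.
  by apply: le_trans (orthoproj_res_norm _ fN) _; rewrite a0 mulr0.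
have ap : 0 < rnorm a by rewrite lt_def a0 rnorm_ge0.
rewrite -ler_pdivrMr// /gap_delta; case: ifP => [/asboolP M0|_].
  by move: Ma a0; rewrite M0 => /= ->; rewrite rnorm0 eqxx.
pose u := of_real s (rnorm a)^-1 *: a.
have nu : modulus (of_real s (rnorm a)^-1) = (rnorm a)^-1.
  by rewrite modulus_real ger0_norm// invr_ge0 ltW.
apply: ub_le_sup.
  exists 1 => _ [x [_ /= x1] <-]; rewrite dist_set_orthoproj// -x1.
  exact: orthoproj_res_norm.
exists u; first by split=> /=; [exact: subspaceZ|rewrite rnormZ nu mulVf].
have sN := fin_dim_subspaceP fN.
rewrite dist_set_orthoproj// -[u]addr0 orthoproj_linear// (orthoproj_id sN (subspace0 sN)).
by rewrite !addr0 -scalerBr rnormZ nu mulrC.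
Qed.

(** Pythagoras: a lower bound 1 / C on the cosine of the angle between [a] and [N] bounds its
    sine. *)
Lemma orthoproj_res_sqrt N (C : R) a : fin_dim_subspace N -> 1 <= C ->
  rnorm a <= C * rnorm (orthoproj N a) ->
  rnorm (a - orthoproj N a) <= Num.sqrt (1 - C ^- 2) * rnorm a.
Proof.
move=> fN C1 h; have C0 : 0 < C by apply: lt_le_trans C1.
have C2 : 0 <= 1 - C ^- 2 by rewrite subr_ge0 invf_le1 ?exprn_gt0// exprn_ege1.
rewrite -ler_sqr ?nnegrE ?mulr_ge0 ?sqrtr_ge0 ?rnorm_ge0// exprMn sqr_sqrtr//.
have e := rnorm_orthoproj a fN.
rewrite mulrBl mul1r {1}e -addrA lerDl subr_ge0 mulrC ler_pdivrMr ?exprn_gt0//.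
by rewrite mulrC -exprMn ler_sqr ?nnegrE ?mulr_ge0 ?rnorm_ge0 ?(ltW C0).
Qed.

End gap_theory.

(** * The operator T_n^dagger T for one finite-dimensional subspace *)

Section compression.
Context {R : realType} {s : scalar_kind} {X Y : hilbertType R s}.
Variable T : {linear X -> Y}.
Hypothesis T_bounded : bounded_operator T.
Hypothesis kerT_finite : fin_dim_subspace (ker T).

Lemma mp_invT x w : orthocomp (range T) w ->
  mp_inv T (T x + w) = x - orthoproj (ker T) x.
Proof.
move=> ow; have /= Tp := orthoproj_mem x kerT_finite.
have -> : T x = T (x - orthoproj (ker T) x) by rewrite linearB Tp subr0.
apply: mp_inv_eq => //; first exact: linearP.
exact: orthoproj_res.
Qed.

Lemma mp_invTT x : mp_inv T (T x) = x - orthoproj (ker T) x.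
Proof.
by rewrite -[T x]addr0 mp_invT//; exact: subspace0 (orthocomp_subspace _).
Qed.

Lemma mp_invTT_id x : orthocomp (ker T) x -> mp_inv T (T x) = x.
Proof.
move=> ox; rewrite mp_invTT (@orthoproj_eq _ _ _ _ _ 0) ?subr0//.
  exact: ker_subspace.
exact: subspace0 (ker_subspace T).
Qed.

Variable V : set X.
Hypothesis fV : fin_dim_subspace V.
Let sV : linear_subspace V := fin_dim_subspaceP fV.

(* [TV] is the T_n^dagger of the paper, [A] is T^dagger T(X_n) and [B] is T^* T(X_n). *)
Let TV := mp_inv (T \o orthoproj V).
Let K := ker T `&` V.
Let A := (mp_inv T \o T) @` V.
Let B := (adjoint T \o T) @` V.

Lemma linear_comp_orthoproj : linear (T \o orthoproj V).
Proof. by move=> k x y /=; rewrite orthoproj_linear// linearP. Qed.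

Lemma fin_dim_kerI : fin_dim_subspace K.
Proof.
apply: fin_dim_sub fV _; first exact: subspaceI (ker_subspace T) sV.
by move=> x [].
Qed.

(** The normal equations of least squares on [V]. The kernel of [T \o orthoproj V] is the sum of [K]
    and the complement of [V], so a vector of [V] orthogonal to [K] is orthogonal to all of it. *)
Lemma mp_inv_comp_eq y x : V x -> orthocomp K x ->
  (forall z, V z -> inner (y - T x) (T z) = 0) -> TV y = x.
Proof.
move=> Vx oK oy; rewrite -[y](subrK (T x)) addrC.
have {1}-> : T x = (T \o orthoproj V) x by rewrite /= orthoproj_id.
apply: mp_inv_eq; first exact: linear_comp_orthoproj.
  move=> a /= Ta; rewrite -(subrK (orthoproj V a) a).
  apply: inner_eq0C; rewrite innerDl (orthoproj_res a fV Vx) add0r.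
  by apply/inner_eq0C/oK; split=> //; apply: orthoproj_mem.
by move=> _ [z _ <-]; apply: oy; apply: orthoproj_mem.
Qed.

(** Project [y] onto T(V), choose a preimage [v] in [V], and remove its component in [K]: this is
    the least-squares solution of minimal norm. *)
Lemma mp_inv_compP y :
  [/\ V (TV y), orthocomp K (TV y) & forall z, V z -> inner (y - T (TV y)) (T z) = 0].
Proof.
have fTV : fin_dim_subspace (T @` V) by apply: fin_dim_image fV; exact: linearP.
have [v Vv e] := orthoproj_mem y fTV.
pose x := v - orthoproj K v.
have [Tp Vp] := orthoproj_mem v fin_dim_kerI.
have Vx : V x by exact: subspaceB.
have oK : orthocomp K x by exact: orthoproj_res fin_dim_kerI.
have oy z : V z -> inner (y - T x) (T z) = 0.
  move=> Vz; rewrite /x linearB Tp subr0 e.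
  by apply: (orthoproj_res y fTV); exists z.
by rewrite (mp_inv_comp_eq Vx oK oy).
Qed.

Lemma mp_inv_comp_res x : orthocomp (range T) x -> forall y, TV (y + x) = TV y.
Proof.
move=> ox y; have [Vy oK oy] := mp_inv_compP y; apply: mp_inv_comp_eq => // z Vz.
by rewrite addrAC innerDl oy// add0r ox//; exists z.
Qed.

Lemma linear_mp_invT : linear (mp_inv T \o T).
Proof.
move=> k x y /=; rewrite !mp_invTT orthoproj_linear//.
by rewrite opprD addrACA scalerBr.
Qed.

Lemma fin_dim_A : fin_dim_subspace A.
Proof. exact: fin_dim_image linear_mp_invT _ fV. Qed.

Lemma inner_adjointT x z : inner x (adjoint T (T z)) = inner (T x) (T z).
Proof. by rewrite -adjointP. Qed.

Lemma inner_adjointTl x z : inner (adjoint T (T z)) x = inner (T z) (T x).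
Proof. by rewrite innerC inner_adjointT -innerC. Qed.

Lemma linear_adjointT : linear (adjoint T \o T).
Proof.
move=> k x y /=; apply/eqP; rewrite -subr_eq0; apply/eqP/inner0_rnorm.
rewrite innerDl innerNl innerDl innerZl !inner_adjointTl.
by rewrite linearP innerDl innerZl subrr.
Qed.

Lemma fin_dim_B : fin_dim_subspace B.
Proof. exact: fin_dim_image linear_adjointT _ fV. Qed.

(** The form in which the normal equations enter the geometry of [A] and [B]. *)
Lemma orthocomp_BP x : orthocomp B x <-> forall z, V z -> inner (T x) (T z) = 0.
Proof.
split=> [h z Vz|h _ [z Vz <-]]; last by rewrite /= inner_adjointT h.
by rewrite -inner_adjointT; apply: h; exists z.
Qed.

Lemma orthocomp_ker_B b : B b -> orthocomp (ker T) b.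
Proof.
by move=> [z _ <-] n /= Tn; apply: inner_eq0C; rewrite inner_adjointT Tn inner0l.
Qed.

Lemma orthocomp_ker_A a : A a -> orthocomp (ker T) a.
Proof. by move=> [z _ <-] /=; rewrite mp_invTT; apply: orthoproj_res. Qed.

Lemma mp_inv_compT_orthoB x : orthocomp B (x - TV (T x)).
Proof.
apply/orthocomp_BP => z Vz; have [_ _] := mp_inv_compP (T x).
by rewrite linearB; apply.
Qed.

Lemma mp_inv_compT_add x w : orthocomp B w -> TV (T (x + w)) = TV (T x).
Proof.
move=> /orthocomp_BP ow; have [Vx oK ox] := mp_inv_compP (T x).
apply: mp_inv_comp_eq => // z Vz.
by rewrite linearD addrAC innerDl ox// ow// addr0.
Qed.

Lemma orthocomp_B_mem v : V v -> orthocomp B v -> T v = 0.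
Proof. by move=> Vv /orthocomp_BP/(_ _ Vv)/inner0_rnorm. Qed.

(** [T] is injective on the part of [V] orthogonal to [K], hence bounded below there. The constant
    depends on [V]; it serves to keep each single gap below 1. *)
Lemma mp_inv_comp_bounded : exists2 C : R, 1 <= C &
  forall x, rnorm (TV (T x)) <= C * rnorm x.
Proof.
have [D hD] := T_bounded.
have sW := subspaceI sV (orthocomp_subspace K).
have fW : fin_dim_subspace (V `&` orthocomp K) by apply: fin_dim_sub sW fV _ => x [].
have [|c c0 hc] := @fin_dim_bounded_below _ _ _ _ T (@linearP _ _ _ _ T) _ fW.
  by move=> x [Vx oK] Tx; apply: (orthocomp_mem0 _ oK); split.
exists (1 + c * `|D|); first by rewrite lerDl mulr_ge0.
move=> x; have [Vx oK ox] := mp_inv_compP (T x).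
(* [T (TV (T x))] is the orthogonal projection of [T x] onto T(V). *)
have h1 : rnorm (T (TV (T x))) <= rnorm (T x).
  rewrite -ler_sqr ?nnegrE ?rnorm_ge0//.
  rewrite -[in leRHS](subrK (T (TV (T x))) (T x)) rnormD_sqr.
  by rewrite (inner_rinner (ox _ Vx)) mulr0 addr0 lerDr sqr_ge0.
apply: le_trans (hc _ (conj Vx oK)) _; rewrite mulrDl mul1r -mulrA.
apply: (@le_trans _ _ (c * (`|D| * rnorm x))); last by rewrite lerDr rnorm_ge0.
rewrite ler_wpM2l//; apply: le_trans h1 _; apply: le_trans (hD x) _.
by rewrite ler_wpM2r ?rnorm_ge0 ?ler_norm.
Qed.

(* [TV \o T] is the identity on [A] up to [ker T] and annihilates the orthogonal
   complement of [B]; hence [|a| <= C |P_B a|] on [A], and dually on [B]. *)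
Lemma gap_le_sqrt (C : R) : 1 <= C -> (forall x, rnorm (TV (T x)) <= C * rnorm x) ->
  gap A B <= Num.sqrt (1 - C ^- 2).
Proof.
move=> C1 hC; rewrite ge_max; apply/andP; split; apply: gap_delta_le.
- exact: fin_dim_B.
- exact: sqrtr_ge0.
- move=> a Aa; apply: orthoproj_res_sqrt => //; first exact: fin_dim_B.
  have e : TV (T a) = TV (T (orthoproj B a)).
    rewrite -[in LHS](subrKC (orthoproj B a) a) mp_inv_compT_add//.
    exact: orthoproj_res fin_dim_B.
  apply: le_trans (hC _); rewrite -e.
  have oa := orthocomp_ker_A Aa.
  (* Here [a] is some [v] in [V] minus its kernel component. [TV (T a) - v] lies in [V] and is
     orthogonal to [B], so [T] kills it. *)
  have Na : T (TV (T a) - a) = 0.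
    have [v Vv ea] := Aa; have [Vx _ ox] := mp_inv_compP (T a).
    have Tav : T a = T v.
      by rewrite -ea /= mp_invTT linearB (orthoproj_mem v kerT_finite) subr0.
    rewrite linearB Tav -linearB; apply: orthocomp_B_mem.
      by apply: subspaceB => //; rewrite -Tav.
    apply/orthocomp_BP => z Vz; rewrite linearB -opprB innerNl -Tav ox//.
    by rewrite oppr0.
  (* [TV (T a)] is [a] plus a kernel vector orthogonal to [a], so it is at least as long as [a]. *)
  rewrite -ler_sqr ?nnegrE ?rnorm_ge0// -(subrK a (TV (T a))) rnormD_sqr.
  by rewrite rinnerC (inner_rinner (oa _ Na)) mulr0 addr0 lerDr sqr_ge0.
- exact: fin_dim_A.
- exact: sqrtr_ge0.
- move=> b Bb; apply: orthoproj_res_sqrt => //; first exact: fin_dim_A.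
  have [b0|b0] := eqVneq (rnorm b) 0.
    by rewrite b0 mulr_ge0 ?rnorm_ge0// (le_trans ler01).
  have bp : 0 < rnorm b by rewrite lt_def b0 rnorm_ge0.
  (* The dual test vector: [q] lies in [A], has norm at most C |b|, and its inner product with [b]
     has real part |b|^2. *)
  set e := TV (T b); set q := e - orthoproj (ker T) e.
  have Aq : A q.
    have [Ve _ _] := mp_inv_compP (T b).
    by exists e => //=; rewrite mp_invTT.
  have e1 : rnorm b ^+ 2 = rinner q (orthoproj A b).
    have h1 : rinner (b - e) b = 0.
      by apply: inner_rinner; apply: mp_inv_compT_orthoB.
    have h2 : rinner (orthoproj (ker T) e) b = 0.
      rewrite rinnerC; apply: inner_rinner; apply: orthocomp_ker_B => //.
      exact: orthoproj_mem.
    have h3 : rinner q (b - orthoproj A b) = 0.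
      by rewrite rinnerC; apply: inner_rinner; apply: (orthoproj_res b fin_dim_A).
    move: h1 h2 h3; rewrite -rinnerxx /q !rinnerBl !rinnerBr; lra.
  have qe : rnorm q <= rnorm e by exact: orthoproj_res_norm.
  rewrite -(ler_pM2l bp) -expr2 e1; apply: le_trans (cauchy_schwarz _ _) _.
  rewrite mulrA ler_wpM2r ?rnorm_ge0//.
  by apply: le_trans qe _; rewrite mulrC; apply: hC.
Qed.

(** With [p] the projection of [u] onto [V], the competitor in [K] is [p - TV (T p)]. As [T u = 0],
    [T p] is [T (p - u)]; the errors |u - p| and |TV (T (p - u))| account for 1 + C. *)
Lemma mp_inv_comp_ker_dist (C : R) u : (forall x, rnorm (TV (T x)) <= C * rnorm x) ->
  ker T u -> dist_set u K <= (1 + C) * rnorm (u - orthoproj V u).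
Proof.
move=> hC Tu; rewrite dist_set_orthoproj; last exact: fin_dim_kerI.
set p := orthoproj V u.
have Vp : V p by exact: orthoproj_mem.
have [Ve oK oe] := mp_inv_compP (T p).
have Kk : K (p - TV (T p)).
  have Vk : V (p - TV (T p)) by exact: subspaceB.
  split=> //; apply: orthocomp_B_mem => //; exact: mp_inv_compT_orthoB.
apply: le_trans (orthoproj_res_le u fin_dim_kerI Kk) _.
rewrite opprB addrA addrAC mulrDl mul1r; apply: le_trans (rnormD _ _) _.
rewrite lerD2l.
have -> : T p = T (p - u) by rewrite linearB (Tu : T u = 0) subr0.
by apply: le_trans (hC _) _; rewrite rnormB.
Qed.

Section kernel_inside.
Hypothesis NV : ker T `<=` V.

(** Once the kernel is inside [V], removing the kernel component of a vector of [V] does not leave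
    [V]. *)
Lemma mem_AP x : A x <-> V x /\ orthocomp (ker T) x.
Proof.
split=> [Ax|[Vx ox]]; last by exists x => //=; rewrite mp_invTT_id.
split; last exact: orthocomp_ker_A.
have [v Vv <-] := Ax; rewrite /= mp_invTT; apply: subspaceB => //.
by apply: NV; apply: orthoproj_mem.
Qed.

Lemma orthoproj_orthocomp_ker x : orthocomp (ker T) x -> orthocomp (ker T) (orthoproj V x).
Proof.
move=> ox; rewrite -(subKr x (orthoproj V x)).
apply: (subspaceB (orthocomp_subspace _) ox) => n Nn.
exact: (orthoproj_res x fV (NV Nn)).
Qed.

Lemma mp_inv_comp_gap x : orthocomp (ker T) x ->
  rnorm (TV (T x) - orthoproj V x) <= gap A B * rnorm (x - TV (T x)).
Proof.
move=> ox; set e := TV (T x) - _; set w := x - _.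
have [Ve oK _] := mp_inv_compP (T x).
have Vp : V (orthoproj V x) by exact: orthoproj_mem.
have Ae : A e.
  apply/mem_AP; split; first exact: subspaceB.
  apply: (subspaceB (orthocomp_subspace _)); last exact: orthoproj_orthocomp_ker.
  by move=> n Nn; apply: oK; split=> //; apply: NV.
have [e0|e0] := eqVneq (rnorm e) 0.
  by rewrite e0 mulr_ge0 ?rnorm_ge0 ?gap_ge0.
have ep : 0 < rnorm e by rewrite lt_def e0 rnorm_ge0.
(* [x - orthoproj V x] is [w + e] and is orthogonal to [e], whence |e|^2 = <-w, e>; as [w] is
   orthogonal to [B], only the residual of [e] off [B] counts. *)
have h1 : rnorm e ^+ 2 = rinner (- w) (e - orthoproj B e).
  have hB : rinner w (orthoproj B e) = 0.
    apply: inner_rinner; apply: mp_inv_compT_orthoB.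
    exact: orthoproj_mem fin_dim_B.
  have hz : rinner (x - orthoproj V x) e = 0.
    by apply: inner_rinner; apply: (orthoproj_res x fV); apply: subspaceB.
  have hx : x - orthoproj V x = w + e by rewrite /e /w addrA subrK.
  by move: hz; rewrite hx rinnerDl rinnerNl rinnerBr hB -rinnerxx; lra.
rewrite -(ler_pM2r ep) -expr2 h1; apply: le_trans (cauchy_schwarz _ _) _.
rewrite rnormN -mulrA mulrCA ler_wpM2l ?rnorm_ge0//.
apply: le_trans (gap_delta_orthoproj (fin_dim_subspaceP fin_dim_A) fin_dim_B Ae) _.
by rewrite ler_wpM2r ?rnorm_ge0// le_max lexx.
Qed.

(** With z = [TV (T x)], Pythagoras splits |x - z|^2 into the squared distance to [V] and |P_V x -
    z|^2; the latter is at most gap^2 |x - z|^2 and is absorbed on the left. *)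
Lemma mp_inv_comp_error x : orthocomp (ker T) x -> gap A B < 1 ->
  rnorm (TV (T x) - x) <= dist_set x V / Num.sqrt (1 - gap A B ^+ 2).
Proof.
move=> ox g1; have g0 : 0 <= gap A B := gap_ge0 _ _.
have q0 : 0 < 1 - gap A B ^+ 2 by rewrite subr_gt0 expr_lt1.
rewrite ler_pdivlMr ?sqrtr_gt0// dist_set_orthoproj//.
rewrite -ler_sqr ?nnegrE ?mulr_ge0 ?rnorm_ge0 ?sqrtr_ge0// exprMn sqr_sqrtr ?(ltW q0)//.
have [Ve _ _] := mp_inv_compP (T x).
have h := mp_inv_comp_gap ox.
have {h} : rnorm (TV (T x) - orthoproj V x) ^+ 2 <= (gap A B * rnorm (x - TV (T x))) ^+ 2.
  by rewrite ler_sqr ?nnegrE ?mulr_ge0 ?rnorm_ge0.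
have := orthoproj_pythagoras x fV Ve.
rewrite (rnormB (orthoproj V x)) (rnormB (TV (T x)) x) exprMn; lra.
Qed.

(** First link of the cycle: zero gap, commutation with the projection, [B] inside [V], zero gap. *)
Lemma gap_eq0_comm : gap A B = 0 ->
  forall x, orthocomp (ker T) x -> TV (T x) = orthoproj V x.
Proof.
move=> g0 x ox; apply/eqP; rewrite -subr_eq0; apply/eqP/rnorm_eq0/eqP.
by rewrite eq_le rnorm_ge0 andbT; have := mp_inv_comp_gap ox; rewrite g0 mul0r.
Qed.

(** For [b] in [B], the residual b - P_V b equals [b - TV (T b)]; it is thus orthogonal to [b] as
    well as to P_V b, hence to itself. *)
Lemma orthoproj_comm_sub :
  (forall x, orthocomp (ker T) x -> TV (T x) = orthoproj V x) -> B `<=` V.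
Proof.
move=> h b Bb; have e := h _ (orthocomp_ker_B Bb).
have := mp_inv_compT_orthoB b; rewrite e => /(_ _ Bb)/inner_rinner h1.
have Vp := orthoproj_mem b fV.
have /inner_rinner h2 := orthoproj_res b fV Vp.
have : rnorm (b - orthoproj V b) ^+ 2 = 0 by rewrite -rinnerxx rinnerBr h1 h2 subr0.
move=> /eqP; rewrite sqrf_eq0 => /eqP/rnorm_eq0/eqP; rewrite subr_eq0 => /eqP ->.
exact: Vp.
Qed.

(** For [a] in [A], the residual off [B] lies in [V] and is orthogonal to [B], so it is in the
    kernel; it is also orthogonal to the kernel, hence zero. In the other direction [mem_AP] puts
    [B] inside [A]. *)
Lemma gap_eq0_sub : B `<=` V -> gap A B = 0.
Proof.
move=> BV; apply/eqP; rewrite eq_le gap_ge0 andbT ge_max.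
apply/andP; split; apply: gap_delta_le => //.
- exact: fin_dim_B.
- move=> a /mem_AP[Va oa]; rewrite mul0r.
  have Bp := orthoproj_mem a fin_dim_B.
  have oB := orthoproj_res a fin_dim_B.
  have Tr : ker T (a - orthoproj B a).
    by apply: orthocomp_B_mem => //; apply: subspaceB => //; apply: BV.
  rewrite (orthocomp_mem0 Tr) ?rnorm0//.
  exact: subspaceB (orthocomp_subspace _) oa (orthocomp_ker_B Bp).
- exact: fin_dim_A.
- move=> b Bb; rewrite orthoproj_id ?subrr ?rnorm0 ?mul0r//.
    exact: fin_dim_subspaceP fin_dim_A.
  by apply/mem_AP; split; [exact: BV|exact: orthocomp_ker_B].
Qed.

End kernel_inside.

End compression.

(** * Arcsine on [0, 1) and suprema in the extended reals *)

Section angles.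
Context {R : realType}.
Implicit Types (g t : R).

(** A negative arcsine would make [sin (- asin g)] positive, that is, [g] negative. *)
Lemma asin_ge0_ltpi2 g : 0 <= g < 1 -> 0 <= asin g < pi / 2.
Proof.
move=> /andP[g0 g1]; have gI : -1 <= g <= 1 by rewrite (ltW g1) andbT (le_trans _ g0)// lerN10.
rewrite asin_ltpi2 ?g1 ?andbT; last by case/andP: gI => ->.
rewrite leNgt; apply/negP => a0.
have : 0 < sin (- asin g).
  apply: sin_gt0_pihalf; rewrite oppr_gt0 a0 /= ltrNl.
  apply: asin_gtNpi2; rewrite (ltW g1) andbT; apply: lt_le_trans g0.
  by rewrite ltrN10.
by rewrite sinN asinK ?in_itv//= oppr_gt0 ltNge g0.
Qed.

Lemma asin_in g : 0 <= g < 1 -> asin g \in `[- (pi / 2), pi / 2].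
Proof.
move=> /asin_ge0_ltpi2/andP[h1 h2]; rewrite in_itv /= (ltW h2) andbT.
by apply: le_trans h1; rewrite oppr_le0 divr_ge0 ?pi_ge0.
Qed.

Lemma sin_asin g : 0 <= g < 1 -> sin (asin g) = g.
Proof.
by move=> /andP[g0 g1]; rewrite asinK// in_itv /= (ltW g1) andbT (le_trans _ g0)// lerN10.
Qed.

Lemma le_asin g t : 0 <= g < 1 -> 0 <= t < 1 -> g <= t -> asin g <= asin t.
Proof.
move=> hg ht gt; rewrite leNgt; apply/negP => h.
have /andP[a0 a1] := asin_ge0_ltpi2 hg; have /andP[b0 b1] := asin_ge0_ltpi2 ht.
have := ltr_sin (asin_in ht) (asin_in hg); rewrite h !sin_asin// => /esym.
by rewrite ltNge gt.
Qed.

Lemma cos_asin_gt0 g : 0 <= g < 1 -> 0 < cos (asin g).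
Proof.
move=> /asin_ge0_ltpi2/andP[h1 h2]; apply: cos_gt0_pihalf; rewrite h2 andbT.
by apply: lt_le_trans h1; rewrite oppr_lt0 divr_gt0 ?pi_gt0.
Qed.

Lemma sqrt_tan_asin g : 0 <= g < 1 ->
  Num.sqrt (1 + tan (asin g) ^+ 2) = (cos (asin g))^-1.
Proof.
move=> hg; have c0 := cos_asin_gt0 hg.
by rewrite -cos2_tan2 ?gt_eqF// -exprVn sqrtr_sqr ger0_norm// invr_ge0 ltW.
Qed.

Lemma cos_asinE g : 0 <= g < 1 -> cos (asin g) = Num.sqrt (1 - g ^+ 2).
Proof.
by move=> /andP[g0 g1]; rewrite cos_asin// (ltW g1) andbT (le_trans _ g0)// lerN10.
Qed.

Lemma asin_eq0 g : 0 <= g < 1 -> asin g = 0 <-> g = 0.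
Proof.
move=> hg; split=> [h|->]; first by rewrite -(sin_asin hg) h sin0.
by rewrite -{1}(@sin0 R) sinK// in_itv /= oppr_le0 divr_ge0 ?pi_ge0.
Qed.

(** The witness [t] is the supremum itself, finite because it lies above [u 0] and below [b]. *)
Lemma ereal_sup_lt_fin (u : nat -> R) (b : R) :
  (ereal_sup (range (fun n => (u n)%:E)) < b%:E)%E <-> exists2 t, t < b & forall n, u n <= t.
Proof.
split=> [|[t tb ut]]; last first.
  apply: (@le_lt_trans _ _ t%:E); last by rewrite lte_fin.
  by apply: ge_ereal_sup => _ [n _ <-]; rewrite lee_fin.
set S := ereal_sup _ => Sb.
have uS n : ((u n)%:E <= S)%E by apply: ereal_sup_ubound; exists n.
have S0 : S \is a fin_num.
  rewrite fin_numE; apply/andP; split; apply/eqP => e; last by move: Sb; rewrite e.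
  by have := uS 0%N; rewrite e.
exists (fine S) => [|n]; first by rewrite -lte_fin fineK.
by rewrite -lee_fin fineK.
Qed.

Lemma ereal_sup_lty (u : nat -> \bar R) : (forall n, 0 <= u n)%E ->
  (ereal_sup (range u) < +oo)%E <-> exists t : R, forall n, (u n <= t%:E)%E.
Proof.
move=> u0; split=> [|[t ut]]; last first.
  by apply: (@le_lt_trans _ _ t%:E); rewrite ?ltry//; apply: ge_ereal_sup => _ [n _ <-].
set S := ereal_sup _ => Sb.
have uS n : (u n <= S)%E by apply: ereal_sup_ubound; exists n.
exists (fine S) => n; rewrite fineK//.
by rewrite ge0_fin_numE// (le_trans (u0 0%N) (uS 0%N)).
Qed.

End angles.

(** * Operator norm *)

Section operator_norm.
Context {R : realType} {s : scalar_kind} {X Y : hilbertType R s}.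

Lemma opnorm_ge0 (f : X -> Y) : (0 <= opnorm f)%E.
Proof.
apply: (@le_trans _ _ (rnorm (f 0))%:E); first by rewrite lee_fin rnorm_ge0.
by apply: ereal_sup_ubound; exists 0 => //=; rewrite rnorm0.
Qed.

(** Real homogeneity serves to normalize [x], and with r = 0 it gives the value at 0. *)
Lemma opnorm_leP (f : X -> Y) (C : R) : (forall r x, f (of_real s r *: x) = of_real s r *: f x) ->
  0 <= C -> (opnorm f <= C%:E)%E <-> forall x, rnorm (f x) <= C * rnorm x.
Proof.
move=> fZ C0; split=> [h x|h].
  have [x0|x0] := eqVneq (rnorm x) 0.
    rewrite (rnorm_eq0 x0) -(scale0r (0 : X)) -(of_real0 (R := R)) fZ of_real0 scale0r.
    by rewrite rnorm0 mulr_ge0 ?rnorm_ge0.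
  have xp : 0 < rnorm x by rewrite lt_def x0 rnorm_ge0.
  have nx : modulus (of_real s (rnorm x)^-1) = (rnorm x)^-1.
    by rewrite modulus_real ger0_norm// invr_ge0 ltW.
  rewrite -ler_pdivrMr// mulrC -nx -rnormZ -fZ -lee_fin; apply: le_trans h.
  by apply: ereal_sup_ubound; exists (of_real s (rnorm x)^-1 *: x) => //=; rewrite rnormZ nx mulVf.
apply: ge_ereal_sup => _ [x /= x1 <-]; rewrite lee_fin; apply: le_trans (h x) _.
by rewrite ler_piMr.
Qed.

End operator_norm.

(** * Condition (KA) and bounds along the sequence *)

Section kernel_approximation.
Context {R : realType} {s : scalar_kind} {X Y : hilbertType R s}.
Variables (T : {linear X -> Y}) (Xn : nat -> set X).
Hypothesis T_bounded : bounded_operator T.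
Hypothesis kerT_finite : fin_dim_subspace (ker T).
Hypothesis fXn : forall n, fin_dim_subspace (Xn n).

Let fK n : fin_dim_subspace (ker T `&` Xn n) := fin_dim_kerI T (fXn n).

(** A uniform estimate with factor 1 / 2 is enough: the residual [r] of a kernel vector is again in
    the kernel and projects to 0, so |r| <= |r| / 2. *)
Lemma kernel_approximability_eventually : kernel_approximability T Xn ->
  exists n0 : nat, forall n, (n0 <= n)%N -> ker T `<=` Xn n.
Proof.
move=> KA; have cvgK x : ker T x -> dist_set x (ker T `&` Xn n) @[n --> \oo] --> (0 : R).
  by rewrite {1}KA.
have [|n0 hn] := orthoproj_res_uniform kerT_finite fK cvgK (e := 1 / 2).
  by rewrite divr_gt0.
exists n0 => n /hn {}hn x Nx; set r := x - orthoproj (ker T `&` Xn n) x.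
have [Np Xp] := orthoproj_mem x (fK n).
have Nr : ker T r by exact: subspaceB (ker_subspace T) Nx Np.
have r0 : orthoproj (ker T `&` Xn n) r = 0.
  have sK := fin_dim_subspaceP (fK n).
  apply: orthoproj_eq => //; first exact: subspace0.
  by rewrite subr0; apply: orthoproj_res.
have := hn _ Nr; rewrite r0 subr0 => hr.
have /rnorm_eq0 /eqP : rnorm r = 0.
  by apply/eqP; rewrite eq_le rnorm_ge0 andbT; lra.
by rewrite subr_eq0 => /eqP ->.
Qed.

(** The inclusion in (KA) that always holds: [T] vanishes on the approximating spaces, so |T x| is
    at most a constant times each distance. *)
Lemma dist_kernel_cvg0 x :
  dist_set x (ker T `&` Xn n) @[n --> \oo] --> (0 : R) -> ker T x.
Proof.
move=> /cvgrPdist_lt h; have [D hD] := T_bounded.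
apply/rnorm_eq0/eqP; rewrite eq_le rnorm_ge0 andbT.
apply/ler_addgt0Pr => e e0; rewrite add0r.
have D0 : 0 < `|D| + 1 by rewrite ltr_wpDl.
have [n _ /(_ n (leqnn n))] := h _ (divr_gt0 e0 D0).
rewrite /= sub0r normrN dist_set_orthoproj// => /ltW/(le_trans (ler_norm _)) hx.
have [Np _] := orthoproj_mem x (fK n).
have -> : T x = T (x - orthoproj (ker T `&` Xn n) x) by rewrite linearB Np subr0.
apply: le_trans (hD _) _; apply: (@le_trans _ _ (`|D| * (e / (`|D| + 1)))).
  apply: le_trans (ler_wpM2r (rnorm_ge0 _) (ler_norm D)) _.
  by rewrite ler_wpM2l.
rewrite mulrA ler_pdivrMr// mulrC ler_wpM2l ?(ltW e0)//.
by rewrite lerDl.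
Qed.

Lemma bounded_kernel_approximability (C : R) : 1 <= C ->
  (forall x : X, orthoproj (Xn n) x @[n --> \oo] --> x) ->
  (forall n x, rnorm (mp_inv (T \o orthoproj (Xn n)) (T x)) <= C * rnorm x) ->
  kernel_approximability T Xn.
Proof.
move=> C1 cvgP hC; apply/seteqP; split=> [u Nu|x]; last exact: dist_kernel_cvg0.
have C0 : 0 < 1 + C by rewrite ltr_wpDr// (le_trans ler01).
apply/cvgrPdist_lt => e e0.
have /cvg_rnormP/(_ _ (divr_gt0 e0 C0))[n0 h0] := cvgP u.
exists n0 => // n /= /h0 h.
have d0 : 0 <= dist_set u (ker T `&` Xn n) by rewrite dist_set_orthoproj// rnorm_ge0.
rewrite sub0r normrN ger0_norm//.
apply: le_lt_trans (mp_inv_comp_ker_dist T_bounded (fXn n) (hC n) Nu) _.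
by rewrite mulrC -ltr_pdivlMr.
Qed.

Lemma uniform_bound (n0 : nat) (C : R) :
  (forall n, (n0 <= n)%N -> forall x, rnorm (mp_inv (T \o orthoproj (Xn n)) (T x)) <= C * rnorm x) ->
  exists2 D : R, 1 <= D & forall n x, rnorm (mp_inv (T \o orthoproj (Xn n)) (T x)) <= D * rnorm x.
Proof.
move=> hC; have /choice [c hc] n : exists c : R, 1 <= c /\
    forall x, rnorm (mp_inv (T \o orthoproj (Xn n)) (T x)) <= c * rnorm x.
  by have [c c1 h] := mp_inv_comp_bounded T_bounded (fXn n); exists c.
have c0 n : 0 <= c n by apply: le_trans ler01 (hc n).1.
(* Each of the finitely many indices below [n0] has its own bound, and the sum dominates them
   all. *)
exists (1 + `|C| + \sum_(i < n0) c i).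
  by rewrite -addrA lerDl addr_ge0// sumr_ge0.
move=> n x; have [nn|nn] := leqP n0 n.
  apply: le_trans (hC _ nn x) _; rewrite ler_wpM2r ?rnorm_ge0//.
  have := ler_norm C; have : 0 <= \sum_(i < n0) c i by rewrite sumr_ge0.
  lra.
apply: le_trans ((hc n).2 x) _; rewrite ler_wpM2r ?rnorm_ge0//.
rewrite (bigD1 (Ordinal nn))//= addrCA lerDl addr_ge0 ?addr_ge0//.
by rewrite sumr_ge0.
Qed.

End kernel_approximation.

(** * Reduction to the orthogonal complement of the kernel, and assembly *)

Lemma mp_dom_reduce (R : realType) (s : scalar_kind) (X Y : hilbertType R s)
    (T : {linear X -> Y}) (y : Y) : fin_dim_subspace (ker T) -> mp_dom T y ->
  orthocomp (ker T) (mp_inv T y) /\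
  forall V, fin_dim_subspace V ->
    mp_inv (T \o orthoproj V) y = mp_inv (T \o orthoproj V) (T (mp_inv T y)).
Proof.
(* For y = T x + w both inverses ignore [w], and [T x] does not change when the kernel component of
   [x] is removed. *)
move=> fN [_ [x _ <-] [w ow <-]]; rewrite mp_invT//; split; first exact: orthoproj_res.
move=> V fV; rewrite mp_inv_comp_res// linearB.
by have /= -> := orthoproj_mem x fN; rewrite subr0.
Qed.

Lemma mp_dom_range (R : realType) (s : scalar_kind) (X Y : hilbertType R s)
    (T : {linear X -> Y}) (x : X) : mp_dom T (T x).
Proof.
exists (T x); first by exists x.
by exists 0; rewrite ?addr0//; exact: subspace0 (orthocomp_subspace _).
Qed.

Theorem theorem1p2 (R : realType) (s : scalar_kind) (X Y : hilbertType R s)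
    (T : {linear X -> Y}) (Xn : nat -> set X) (Tn : nat -> X -> Y)
    (X_infinite : ~ fin_dim_subspace [set: X])
    (T_bounded : bounded_operator T)
    (kerT_finite : fin_dim_subspace (ker T))
    (XTn_LPA : LPA T Xn Tn) :
  let theta := fun n => offset_angle T (Xn n) in
  let KA := kernel_approximability T Xn in
  ((forall n, 0 <= theta n < pi / 2) /\
   ((ereal_sup (range (fun n => opnorm (mp_inv (Tn n) \o T))) < +oo)%E <->
    KA /\ (ereal_sup (range (fun n => (theta n)%:E)) < (pi / 2)%:E)%E)) /\
  (KA -> exists n0 : nat, forall n, (n0 <= n)%N ->
    (forall y, mp_dom T y ->
       rnorm (mp_inv (Tn n) y - mp_inv T y)
         <= Num.sqrt (1 + tan (theta n) ^+ 2) * dist_set (mp_inv T y) (Xn n)) /\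
    (theta n = 0 <->
       (forall y, mp_dom T y -> mp_inv (Tn n) y = orthoproj (Xn n) (mp_inv T y))) /\
    ((forall y, mp_dom T y -> mp_inv (Tn n) y = orthoproj (Xn n) (mp_inv T y)) <->
       sumset (ker T) ((adjoint T \o T) @` Xn n) `<=` Xn n)).
Proof.
move=> theta KA; have [fXn cvgP TnE] := XTn_LPA.
pose g n := gap ((mp_inv T \o T) @` Xn n) ((adjoint T \o T) @` Xn n).
have sqrt_lt1 (C : R) : 1 <= C -> 0 <= Num.sqrt (1 - C ^- 2) < 1.
  move=> C1; rewrite sqrtr_ge0 /= -[ltRHS]sqrtr1 ltr_sqrt//.
  by rewrite gtrBl invr_gt0 exprn_gt0// (lt_le_trans ltr01).
have g01 n : 0 <= g n < 1.
  have [C C1 hC] := mp_inv_comp_bounded T_bounded (fXn n).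
  rewrite gap_ge0 /=; apply: le_lt_trans (gap_le_sqrt T_bounded kerT_finite (fXn n) C1 hC) _.
  by case/andP: (sqrt_lt1 _ C1).
have theta01 n : 0 <= theta n < pi / 2 by exact: asin_ge0_ltpi2 (g01 n).
(* The factor 1 / sqrt(1 - gap^2) is 1 / cos theta, that is sqrt(1 + tan^2 theta). *)
have error n x : ker T `<=` Xn n -> orthocomp (ker T) x ->
    rnorm (mp_inv (Tn n) (T x) - x) <= Num.sqrt (1 + tan (theta n) ^+ 2) * dist_set x (Xn n).
  move=> NX ox; rewrite sqrt_tan_asin ?g01// cos_asinE ?g01// mulrC TnE.
  by apply: mp_inv_comp_error => //; case/andP: (g01 n).
(* [mp_inv] is a bare function, so homogeneity is read off the normal equations. *)
have homog n r x : (mp_inv (Tn n) \o T) (of_real s r *: x) =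
    of_real s r *: (mp_inv (Tn n) \o T) x.
  rewrite /= TnE; have [Vx oK ox] := mp_inv_compP T (fXn n) (T x).
  apply: mp_inv_comp_eq => //; first exact: subspaceZ (fin_dim_subspaceP (fXn n)) Vx.
    exact: subspaceZ (orthocomp_subspace _) oK.
  by move=> z Vz; rewrite !linearZ /= -scalerDr innerZl ox// mulr0.
have boundedP : (ereal_sup (range (fun n => opnorm (mp_inv (Tn n) \o T))) < +oo)%E <->
    exists2 C : R, 1 <= C &
      forall n x, rnorm (mp_inv (T \o orthoproj (Xn n)) (T x)) <= C * rnorm x.
  rewrite ereal_sup_lty; last by move=> n; apply: opnorm_ge0.
  split=> [[t ht]|[C C1 hC]].
    exists (1 + `|t|); first by rewrite lerDl.
    move=> n x; rewrite -TnE.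
    have t0 : 0 <= 1 + `|t| by rewrite addr_ge0.
    apply: ((opnorm_leP (homog n) t0).1 _ x); apply: le_trans (ht n) _.
    by rewrite lee_fin; have := ler_norm t; lra.
  exists C => n; apply/(opnorm_leP (homog n)) => [|x]; first exact: le_trans ler01 C1.
  by rewrite /= TnE.
split; first split=> //.
  rewrite boundedP ereal_sup_lt_fin; split=> [[C C1 hC]|[hKA [t tpi ht]]].
    split; first exact (bounded_kernel_approximability T_bounded fXn C1 cvgP hC).
    (* [gap_le_sqrt] turns the uniform bound [C] into one angle below pi / 2 valid for all [n]. *)
    exists (asin (Num.sqrt (1 - C ^- 2))).
      by case/andP: (asin_ge0_ltpi2 (sqrt_lt1 _ C1)).
    move=> n; apply: le_asin (g01 n) (sqrt_lt1 _ C1) _.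
    exact: gap_le_sqrt.
  have [n0 NX] := kernel_approximability_eventually kerT_finite fXn hKA.
  have t0 : 0 <= t by apply: le_trans (ht 0%N); case/andP: (theta01 0%N).
  have cost : 0 < cos t.
    apply: cos_gt0_pihalf; rewrite tpi andbT (lt_le_trans _ t0)//.
    by rewrite oppr_lt0 divr_gt0 ?pi_gt0.
  (* With z = T_n^dagger T q, |z| <= |q| + |z - q|, and the error estimate bounds the last term by
     |q| / cos(theta n) <= |q| / cos t. *)
  apply: (uniform_bound T_bounded fXn (n0 := n0) (C := 1 + (cos t)^-1)) => n nn x.
  set q := x - orthoproj (ker T) x.
  have oq : orthocomp (ker T) q by exact: orthoproj_res.
  have qx : rnorm q <= rnorm x by exact: orthoproj_res_norm.
  have -> : T x = T q.
    by rewrite linearB; have /= -> := orthoproj_mem x kerT_finite; rewrite subr0.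
  rewrite -TnE -(subrKC q (mp_inv _ _)) mulrDl mul1r.
  apply: le_trans (rnormD _ _) (lerD qx _).
  apply: le_trans (error n q (NX _ nn) oq) _.
  rewrite sqrt_tan_asin ?g01//; apply: ler_pM.
  - by rewrite invr_ge0 ltW// cos_asin_gt0 ?g01.
  - by rewrite dist_set_orthoproj// rnorm_ge0.
  - rewrite lef_pV2 ?posrE ?cos_asin_gt0 ?g01//.
    have /andP[th0 thpi] := theta01 n.
    have piI (r : R) : 0 <= r -> r < pi / 2 -> r \in `[0, pi].
      move=> r0 rpi; rewrite in_itv /= r0 /=; apply: le_trans (ltW rpi) _.
      by rewrite ler_pdivrMr// ler_peMr ?pi_ge0// ler1n.
    by rewrite leNgt (ltr_cos (piI _ t0 tpi) (piI _ th0 thpi)) -leNgt; apply: ht.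
  - by rewrite dist_set_orthoproj//; apply: le_trans (orthoproj_res_norm _ (fXn n)) qx.
move=> hKA.
have [n0 NX] := kernel_approximability_eventually kerT_finite fXn hKA.
exists n0 => n /NX NXn.
(* On [mp_dom T], T^dagger y runs over the orthogonal complement of the kernel, so the identity may
   be tested at y = T x. *)
have commP : (forall y, mp_dom T y -> mp_inv (Tn n) y = orthoproj (Xn n) (mp_inv T y)) <->
    forall x, orthocomp (ker T) x ->
      mp_inv (T \o orthoproj (Xn n)) (T x) = orthoproj (Xn n) x.
  rewrite TnE; split=> [h x ox|h y /(mp_dom_reduce kerT_finite)[oy ->//]]; last exact: h.
  by rewrite h; [rewrite mp_invTT_id|exact: mp_dom_range].
split=> [y /(mp_dom_reduce kerT_finite)[oy yE]|].
  by rewrite TnE yE// -TnE; apply: error.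
have comm_sub := orthoproj_comm_sub T_bounded (fXn n).
split.
  rewrite commP /theta /offset_angle asin_eq0 ?g01//; split=> [|/comm_sub].
    exact: gap_eq0_comm.
  exact: gap_eq0_sub.
(* The kernel is already inside [Xn n], so the inclusion of the sum amounts to that of its second
   summand. *)
rewrite commP; split=> [/comm_sub BX _ [a Na [b Bb <-]]|h].
  by apply: subspaceD (fin_dim_subspaceP (fXn n)) (NXn _ Na) (BX _ Bb).
have BX : (adjoint T \o T) @` Xn n `<=` Xn n.
  move=> b Bb; apply: h; exists 0; first exact: subspace0 (ker_subspace T).
  by exists b => //; rewrite add0r.
exact: gap_eq0_comm (gap_eq0_sub T_bounded kerT_finite (fXn n) NXn BX).
Qed.
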